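(* Let $n\ge 1$ and let $\mathcal{T}_n$ denote the Temperley–Lieb algebra over $\mathbb{C}(q)$, whose dimension is the $n$th Catalan number, with its basis of non-crossing diagrams on $2n$ points. Then its complexity satisfies $$C(\mathcal{T}_n)\le \frac{n^3+9n^2+8n-12}{6}\dim(\mathcal{T}_n),$$ and this bound is $O\big(\dim(\mathcal{T}_n)\,(\log \dim(\mathcal{T}_n))^3\big)$ as $n\to\infty$.
   Context: Temperley–Lieb algebra. $\mathcal{T}_n$ is the unital $\mathbb{C}(q)$-algebra generated by $e_1,\dots,e_{n-1}$ with relations $e_i^2=qe_i$; $e_ie_j=e_je_i$ for $|i-j|>1$; $e_ie_{i+1}e_i=e_i$ and $e_{i+1}e_ie_{i+1}=e_{i+1}$. Equivalently, it has basis $T_n$ consisting of the diagrams on $2n$ points (a top row and a bottom row of $n$ points each) in which the points are matched in pairs by non-intersecting lines. Products are given by concatenation ($x$ on top of $y$ for $xy$), each closed loop being removed and replaced by a factor $q$. Here $e_i$ is the diagram with a horizontal edge joining points $i,i+1$ in the top row, a horizontal edge joining points $i,i+1$ in the bottom row, and all other edges vertical. $\mathcal{T}_n$ is semisimple. Fourier transform. Let $A$ be a finite-dimensional semisimple algebra over a field $K$ (here $K=\mathbb{C}(q)$) with a fixed basis $\{a_i\}_{i\in I}$ (here $T_n$). For $f=\sum_i f(a_i)a_i\in A$ and a matrix representation $\rho$ of $A$ (an algebra homomorphism $A\to M_d(K)$), put $\hat f(\rho)=\sum_i f(a_i)\rho(a_i)$. For a set $R$ of matrix representations, the Fourier transform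 of $f$ on $R$ is $\bigoplus_{\rho\in R}\hat f(\rho)$. Complexity. Let $+_A(R)$ (resp. $\times_A(R)$) be the minimum number of additions (resp. multiplications) in $K$ needed to compute the Fourier transform of $f$ on $R$ by a straight-line program, for an arbitrary input $f=\sum_i f(a_i)a_i$. A straight-line program is a list of instructions performing the operations $\times,\div,+,-$ on inputs and precomputed values. Put $T_A(R)=\max(+_A(R),\times_A(R))$ and $C(A)=\min_R T_A(R)$, where $R$ ranges over all complete sets of inequivalent irreducible matrix representations of $A$. *)

(* Defs.v *)
From mathcomp Require Import all_boot all_order all_algebra.
From mathcomp Require Import complex.
From mathcomp Require Import all_classical all_reals all_analysis.

Set Implicit Arguments.
Unset Strict Implicit.
Unset Printing Implicit Defensive.

Import Order.TTheory GRing.Theory Num.Theory.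
Import numFieldNormedType.Exports.

Local Open Scope classical_set_scope.
Local Open Scope ring_scope.

(** * Non-crossing diagrams *)

(** [inl i] is the [i]-th point of the top row, [inr i] the [i]-th point of the
    bottom row, both numbered from left to right. *)
Definition point (n : nat) := ('I_n + 'I_n)%type.

(** Position on the boundary of the diagram, read clockwise from the top left
    corner: the bottom row is met from right to left. *)
Definition pos (n : nat) (p : point n) : nat :=
  match p with
  | inl i => i
  | inr i => (n + n).-1 - i
  end.

(** A pairing of the points is stored as the function sending each point to its
    partner. *)
Definition is_matching (n : nat) (d : {ffun point n -> point n}) : bool :=
  [forall p, (d (d p) == p) && (d p != p)].

Definition crossing (n : nat) (d : {ffun point n -> point n})
    (p r : point n) : bool :=
  [&& (pos p < pos r)%N, (pos r < pos (d p))%N & (pos (d p) < pos (d r))%N].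

Definition is_diagram (n : nat) (d : {ffun point n -> point n}) : bool :=
  is_matching d && [forall p, forall r, ~~ crossing d p r].

Definition diagram (n : nat) : finType :=
  {d : {ffun point n -> point n} | is_diagram d}.

Definition is_id_diagram (n : nat) (d : diagram n) : bool :=
  [forall i, val d (inl i) == inr i].

(** ** Concatenation

    Placing [x] on top of [y] identifies the bottom row of [x] with the top row
    of [y]; this leaves three rows of points, top, middle and bottom. *)
Definition stack_point (n : nat) := ('I_n + 'I_n + 'I_n)%type.

Definition upper (n : nat) (p : point n) : stack_point n :=
  match p with inl i => inl (inl i) | inr i => inl (inr i) end.

Definition lower (n : nat) (p : point n) : stack_point n :=
  match p with inl i => inl (inr i) | inr i => inr i end.

Definition outer (n : nat) (p : point n) : stack_point n :=
  match p with inl i => inl (inl i) | inr i => inr i end.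

Definition stack_edge (n : nat) (x y : diagram n) : rel (stack_point n) :=
  fun u v =>
    [exists p, (u == upper p) && (v == upper (val x p))]
    || [exists p, (u == lower p) && (v == lower (val y p))].

(** [z] is what remains of the stack of [x] and [y] once the closed loops are
    removed: every outer point is matched with the other end of its line. *)
Definition concatenation (n : nat) (x y z : diagram n) : bool :=
  [forall p, connect (stack_edge x y) (outer p) (outer (val z p))].

(** The closed loops are the connected components of the stack which contain
    no outer point. *)
Definition loops (n : nat) (x y : diagram n) : nat :=
  n_comp (stack_edge x y)
    [pred v | [forall p : point n, ~~ connect (stack_edge x y) v (outer p)]].

(** * The Temperley-Lieb algebra over C(q) *)

Definition Cq (R : realType) : fieldType := {fraction {poly R[i]}}.

Definition q (R : realType) : Cq R := tofrac 'X.

(** An element is given by its coordinates in the basis of diagrams. *)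
Definition TL (R : realType) (n : nat) : vectType (Cq R) :=
  {ffun diagram n -> (Cq R)^o}.

Definition TLbasis (R : realType) (n : nat) (a : diagram n) : TL R n :=
  [ffun c => (c == a)%:R].

Definition TLone (R : realType) (n : nat) : TL R n :=
  [ffun c => (is_id_diagram c)%:R].

(** Bilinear extension of [x y = q ^ (loops x y) z], where [z] is the
    concatenation of [x] and [y]. *)
Definition TLmul (R : realType) (n : nat) (f g : TL R n) : TL R n :=
  [ffun c => \sum_(a : diagram n) \sum_(b : diagram n | concatenation a b c)
               (f a : Cq R) * g b * q R ^+ loops a b].

(** * Matrix representations and Fourier transforms *)

Record mxrep (R : realType) (n : nat) := MxRep {
  rdim : nat;
  rmap :> {linear TL R n -> 'M[Cq R]_rdim};
  rmap1 : rmap (TLone R n) = 1%:M;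
  rmapM : forall f g : TL R n, rmap (TLmul f g) = rmap f *m rmap g
}.

Definition equivalent (R : realType) (n : nat) (rho sigma : mxrep R n) : Prop :=
  exists (P : 'M[Cq R]_(rdim rho, rdim sigma))
         (Q : 'M[Cq R]_(rdim sigma, rdim rho)),
    [/\ P *m Q = 1%:M, Q *m P = 1%:M &
        forall f : TL R n, rho f = P *m sigma f *m Q].

Definition irreducible (R : realType) (n : nat) (rho : mxrep R n) : Prop :=
  (0 < rdim rho)%N /\
  forall W : {vspace 'cV[Cq R]_(rdim rho)},
    (forall (f : TL R n) v, v \in W -> rho f *m v \in W) ->
    W = 0%VS \/ W = fullv.

Definition complete_irreducibles (R : realType) (n : nat)
    (S : set (mxrep R n)) : Prop :=
  [/\ forall rho, S rho -> irreducible rho,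
      forall rho sigma, S rho -> S sigma -> equivalent rho sigma ->
        rho = sigma &
      forall sigma, irreducible sigma -> exists2 rho, S rho & equivalent rho sigma].

Definition fourier (R : realType) (n : nat) (f : TL R n) (rho : mxrep R n) :
    'M[Cq R]_(rdim rho) :=
  \sum_(a : diagram n) (f a : Cq R) *: rho (TLbasis R a).

(** * Straight-line programs *)

(** [Reg k] is the result of the [k]-th instruction; constants are values which
    do not depend on the input. *)
Inductive operand (K : fieldType) (I : finType) :=
  | Input of I
  | Const of K
  | Reg of nat.

Inductive arith := Add | Sub | Mul | Div.

Record instr (K : fieldType) (I : finType) := Instr {
  iop : arith;
  iarg1 : operand K I;
  iarg2 : operand K I
}.

Definition slp (K : fieldType) (I : finType) := seq (instr K I).

Definition opval (K : fieldType) (I : finType) (f : I -> K) (s : seq K)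
    (o : operand K I) : option K :=
  match o with
  | Input i => Some (f i)
  | Const c => Some c
  | Reg k => onth s k
  end.

Definition arith_val (K : fieldType) (op : arith) (u v : K) : option K :=
  match op with
  | Add => Some (u + v)
  | Sub => Some (u - v)
  | Mul => Some (u * v)
  | Div => if v == 0 then None else Some (u / v)
  end.

Definition step (K : fieldType) (I : finType) (f : I -> K)
    (s : option (seq K)) (c : instr K I) : option (seq K) :=
  obind (fun s : seq K =>
    obind (fun u : K =>
      obind (fun v : K =>
        omap (rcons s) (arith_val (iop c) u v))
      (opval f s (iarg2 c)))
    (opval f s (iarg1 c))) s.

(** The sequence of all results of [p] on the input [f]; undefined in case of a
    division by zero or of a reference to a later instruction. *)
Definition run (K : fieldType) (I : finType) (p : slp K I) (f : I -> K) :
    option (seq K) :=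
  foldl (step f) (Some [::]) p.

(** A subtraction counts as an addition and a division as a multiplication. *)
Definition additions (K : fieldType) (I : finType) (p : slp K I) : nat :=
  count (fun c => match iop c with Add | Sub => true | _ => false end) p.

Definition multiplications (K : fieldType) (I : finType) (p : slp K I) : nat :=
  count (fun c => match iop c with Mul | Div => true | _ => false end) p.

(** Each entry of each matrix is found at a place which does not depend on the
    input. *)
Definition computes_fourier (R : realType) (n : nat)
    (p : slp (Cq R) (diagram n)) (S : set (mxrep R n)) : Prop :=
  forall rho, S rho -> forall i j : 'I_(rdim rho),
    exists o : operand (Cq R) (diagram n), forall f : TL R n,
      exists2 s, run p f = Some s & opval f s o = Some (fourier f rho i j).

(** * Complexity

    The minima are taken in the extended reals, where that of the empty set is
    [+oo]. *)

Definition add_cost (R : realType) (n : nat) (S : set (mxrep R n)) : \bar R :=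
  ereal_inf [set (additions p)%:R%:E | p in [set p | computes_fourier p S]].

Definition mul_cost (R : realType) (n : nat) (S : set (mxrep R n)) : \bar R :=
  ereal_inf
    [set (multiplications p)%:R%:E | p in [set p | computes_fourier p S]].

Definition cost (R : realType) (n : nat) (S : set (mxrep R n)) : \bar R :=
  maxe (add_cost S) (mul_cost S).

Definition complexity (R : realType) (n : nat) : \bar R :=
  ereal_inf [set cost S | S in @complete_irreducibles R n].

Definition TLdim (R : realType) (n : nat) : nat := \dim {: TL R n}.

Definition catalan (n : nat) : nat := 'C(n.*2, n) %/ n.+1.

Definition TLbound (R : realType) (n : nat) : R :=
  (n%:R ^+ 3 + 9 * n%:R ^+ 2 + 8 * n%:R - 12) / 6 * (TLdim R n)%:R.

(* Main.v *)
From HB Require Import structures.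
From mathcomp Require Import all_boot all_order all_algebra.
From mathcomp Require Import complex.
From mathcomp Require Import all_classical all_reals all_analysis.
From mathcomp Require Import zify ring lra.
Require Import Defs.

(** The irreducible representations are used in their path form, in which
    every diagram has explicit matrix entries.  A path is a sequence of
    heights, starting at 0 and moving by steps of 1.  Read the 2n boundary
    points of a diagram clockwise, and think of the heights in the gaps between
    them as colours of the regions that the arcs cut out.  The state sum of the
    diagram at a path is 0 unless the heights are constant on the regions, and
    otherwise the product over the arcs of a weight: 1 if the height rises on
    entering the arc, [a] / [a + 1] if it falls from a.  Here [a] is the quantum
    integer, with q [a] = [a + 1] + [a - 1].  Cutting a path of length 2n in
    the middle gives two paths of length n which end at the same height k; up
    to a scaling of the columns the state sums are then the entries of the
    k-th representation.

    These matrices multiply correctly because a generator, which joins two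
    neighbouring points and their former mates, acts on state sums by changing
    a single height (statesum_cupcap_loop and statesum_cupcap), and because
    every diagram arises from the identity by generators (diagram_cup_ind).
    The stacking of diagrams, given through connectivity, is reached through
    another state sum of the same kind: the number of two-colourings of the
    stack with given outer colours is 2 ^ loops or 0, and these numbers
    determine the concatenation and the number of loops (colourings_unique,
    colourings_loops).  Both models follow the generators in the same way, so
    one induction treats them together (diagram_product).

    The transform has to evaluate, for each path of length 2n, the sum over all
    diagrams of a coefficient times a state sum.  Paths correspond to diagrams,
    the height being the number of arcs above a gap, so the coefficients can be
    transformed in place.  In stage m the state sums are restricted to the
    paths which agree with the heights of the diagram up to position m.  If an
    arc closes at m, the next height is forced and nothing changes.  If an arc
    opens at m at height k, the paths that fall there have to be redistributed
    to other diagrams; by the recursion of Jones and Wenzl, which is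
    statesum_exchange here, at most k of them are needed, each with a known
    coefficient.  As k < n and there are 2n stages, at most 2n (n - 1)
    multiplications and additions are spent per diagram, and one more of each
    for the scaling of the columns.

    Each in-place update is invertible.  Hence the representations together
    give a bijection from the algebra onto the product of the matrix algebras,
    and preimages of the matrix units show that they are irreducible, pairwise
    inequivalent and exhaust all irreducible representations.  The dimension is
    counted by ballot words; it is at least 2 ^ (n - 1), so that n - 1 is at
    most its binary logarithm. *)

Set Implicit Arguments.
Unset Strict Implicit.
Unset Printing Implicit Defensive.

Import Order.TTheory GRing.Theory Num.Theory.
Import numFieldNormedType.Exports.

(** * Rewiring non-crossing matchings *)

(** Which side of the chord from [u] to [v] contains [z].  The exclusive or is
    symmetric in the two ends, so a chord needs no orientation. *)
Definition side (u v z : nat) : bool := (u < z) (+) (v < z).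

(** Matchings are plain functions on positions, so that questions about order
    are arithmetic.  Planarity says that no chord separates a point from its
    mate. *)
Definition ncmatch (N : nat) (f : nat -> nat) : Prop :=
  [/\ forall x, x < N -> f x < N, forall x, x < N -> f (f x) = x,
      forall x, x < N -> f x != x &
      forall x z, x < N -> z < N -> z != x -> z != f x ->
        side x (f x) z = side x (f x) (f z)].

(** The common form of all moves on diagrams below.  Rewiring at [a] and its
    former mate undoes the move. *)
Definition rewire (f : nat -> nat) (a b : nat) : nat -> nat := fun z =>
  if z == a then b else if z == b then a else
  if z == f a then f b else if z == f b then f a else f z.

Lemma side_sym x y z w : x != z -> x != w -> y != z -> y != w -> 
  (side x y z == side x y w) = (side z w x == side z w y).
Proof. rewrite /side. lia. Qed.

(** A chord which has [a] and [b] on one side also has their mates on that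
    side, since it separates neither of the two old arcs. *)
Lemma rewire_ncmatch N f a b : ncmatch N f -> a < N -> b < N -> a != b ->
  f a != b ->
  (forall z, z < N -> z != a -> z != b -> z != f a -> z != f b ->
     side z (f z) a = side z (f z) b) ->
  side a b (f a) = side a b (f b) ->
  ncmatch N (rewire f a b).
Proof.
move=> [fN ff fx nc] aN bN ab fab vis sfab.
have fba : f b != a by apply/eqP => e; move: fab; rewrite -e ff // eqxx.
have fafb : f a != f b by apply/eqP => e; move: ab; rewrite -(ff a aN) e ff // eqxx.
have faN := fN _ aN; have fbN := fN _ bN.
have fax := fx _ aN; have fbx := fx _ bN.
have other z : z < N -> z != a -> z != b -> z != f a -> z != f b ->
  [/\ f z != a, f z != b, f z != f a & f z != f b].
  move=> zN za zb zfa zfb; split; apply/eqP => e.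
  - by move: zfa; rewrite -e ff // eqxx.
  - by move: zfb; rewrite -e ff // eqxx.
  - by move: za; rewrite -(ff z zN) e ff // eqxx.
  - by move: zb; rewrite -(ff z zN) e ff // eqxx.
have ra : rewire f a b a = b by rewrite /rewire eqxx.
have rb : rewire f a b b = a by rewrite /rewire eqxx eq_sym (negbTE ab).
have rfa : rewire f a b (f a) = f b by rewrite /rewire (negbTE fax) (negbTE fab) eqxx.
have rfb : rewire f a b (f b) = f a.
  by rewrite /rewire (negbTE fba) (negbTE fbx) eq_sym (negbTE fafb) eqxx.
have ro z : z != a -> z != b -> z != f a -> z != f b -> rewire f a b z = f z.
  by move=> *; rewrite /rewire !ifN.
have cases z : [\/ z = a, z = b, z = f a | z = f b] \/
    [/\ z != a, z != b, z != f a & z != f b].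
  case: (eqVneq z a) => [->|?]; first by left; constructor 1.
  case: (eqVneq z b) => [->|?]; first by left; constructor 2.
  case: (eqVneq z (f a)) => [->|?]; first by left; constructor 3.
  case: (eqVneq z (f b)) => [->|?]; first by left; constructor 4.
  by right.
split.
- move=> x xN; case: (cases x) => [[]->|[xa xb xfa xfb]]; rewrite ?ra ?rb ?rfa ?rfb //.
  by rewrite ro // fN.
- move=> x xN; case: (cases x) => [[]->|[xa xb xfa xfb]]; rewrite ?ra ?rb ?rfa ?rfb ?ra ?rb ?rfa ?rfb //.
  by have [? ? ? ?] := other x xN xa xb xfa xfb; rewrite !ro // ff.
- move=> x xN; case: (cases x) => [[]->|[xa xb xfa xfb]]; rewrite ?ra ?rb ?rfa ?rfb //.
  + by rewrite eq_sym.
  + by rewrite eq_sym.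
  + by rewrite ro // fx.
- have new x : x < N -> x != a -> x != b -> x != f a -> x != f b ->
   [/\ side x (f x) a = side x (f x) b, side x (f x) (f a) = side x (f x) (f b),
       side a b x = side a b (f x) & side (f a) (f b) x = side (f a) (f b) (f x)].
    move=> xN xa xb xfa xfb.
    have [? ? ? ?] := other x xN xa xb xfa xfb.
    have e1 := vis x xN xa xb xfa xfb.
    have e2 : side x (f x) (f a) = side x (f x) (f b).
      by rewrite -(nc x a) // 1?eq_sym // -(nc x b) // 1?eq_sym.
    by split=> //; apply/eqP; rewrite side_sym 1?eq_sym //; apply/eqP; rewrite ?e1 ?e2.
  have sfab' : side (f a) (f b) a = side (f a) (f b) b.
    by apply/eqP; rewrite side_sym // 1?eq_sym //; apply/eqP.
  move=> x z xN zN.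
  have ss u v w : side u v w = side v u w by rewrite /side addbC.
  case: (cases x) => [xs|[xa xb xfa xfb]]; case: (cases z) => [zs|[za zb zfa zfb]].
  + case: xs => ->; rewrite ?ra ?rb ?rfa ?rfb; case: zs => ->; rewrite ?ra ?rb ?rfa ?rfb ?eqxx //;
    by rewrite ?(ss b a) ?(ss (f b) (f a)).
  + have [? ? ? ?] := new z zN za zb zfa zfb; rewrite (ro z) // => _ _.
    by case: xs => ->; rewrite ?ra ?rb ?rfa ?rfb ?(ss b a) ?(ss (f b) (f a)).
  + have [? ? ? ?] := new x xN xa xb xfa xfb; rewrite (ro x) // => _ _.
    by case: zs => ->; rewrite ?ra ?rb ?rfa ?rfb.
  + by rewrite !ro // => zx zfx; apply: nc.
Qed.

(** * Heights and paths *)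

Lemma ncmatch_mate_neq N f x y : ncmatch N f -> x < N -> y < N -> x != f y -> f x != y.
Proof. by move=> [_ ff _ _] xN yN; apply: contraNneq => <-; rewrite ff. Qed.

Definition is_path (L k : nat) (h : nat -> nat) : Prop :=
  [/\ h 0 = 0, h L = k &
      forall m, m < L -> h m.+1 = (h m).+1 \/ h m = (h m.+1).+1].

Lemma is_path_le L k h m : is_path L k h -> m <= L -> h m <= m.
Proof.
move=> [h0 _ st]; elim: m => [|m IH] mL; first by rewrite h0.
by have := IH (ltnW mL); have := st m mL; lia.
Qed.

(** The number of arcs above the gap that precedes position [m].  Counting
    arcs, instead of subtracting closers from openers, avoids truncation. *)
Definition height (f : nat -> nat) (m : nat) : nat :=
  \sum_(0 <= x < m) (m <= f x : nat).

Lemma height0 f : height f 0 = 0.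
Proof. by rewrite /height big_geq. Qed.

Lemma heightN N f : ncmatch N f -> height f N = 0.
Proof.
move=> [fN _ _ _]; rewrite /height big_nat big1 // => x /andP[_ /fN].
by rewrite ltnNge => /negbTE ->.
Qed.

Lemma height_up N f m : ncmatch N f -> m < N -> m < f m ->
  height f m.+1 = (height f m).+1.
Proof.
move=> nf mN mf; rewrite /height big_nat_recr //= mf addn1; congr _.+1.
apply: eq_big_nat => x /andP[_ xm].
have : f x != m; last by lia.
apply: (ncmatch_mate_neq nf) => //; lia.
Qed.

Lemma height_down N f m : ncmatch N f -> m < N -> f m < m ->
  height f m = (height f m.+1).+1.
Proof.
move=> nf mN fm; have [fN ff fx _] := nf.
rewrite /height big_nat_recr //= [in RHS]ltnNge ltnW //= addn0.
rewrite (eq_big_nat _ _ (F2 := fun x => (m < f x) + (x == f m))); last first.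
  move=> x /andP[_ xm].
  have -> : (x == f m) = (f x == m); last by lia.
  by apply/eqP/eqP => [->|<-]; rewrite ff //; lia.
rewrite big_split /= -[RHS]addn1; congr (_ + _).
by rewrite -big_mkcond /= big_nat1_eq /= fm.
Qed.

Lemma height_path N f : ncmatch N f -> is_path N 0 (height f).
Proof.
move=> nf; split; [exact: height0|exact: (heightN nf)|] => m mN.
have [_ _ fx _] := nf; have := fx m mN; case: (ltngtP (f m) m) => // ? _.
  by right; apply: height_down mN _.
by left; apply: height_up mN _.
Qed.

Lemma height_ltE N f m : ncmatch N f -> m < N ->
  (height f m < height f m.+1) = (m < f m).
Proof.
move=> nf mN; have [_ _ fx _] := nf; have := fx m mN.
case: (ltngtP (f m) m) => // ? _.
  by rewrite (height_down nf mN) // ltnNge leqW.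
by rewrite (height_up nf mN) // ltnSn.
Qed.

(** Apart from the arc at [x] itself, an arc above the gap at [x] has to pass
    above the whole of that arc. *)
Lemma height_under N f x z : ncmatch N f -> x < N -> x < z -> z <= f x ->
  height f x < height f z.
Proof.
move=> nf xN xz zfx; have [fN ff fx nc] := nf.
rewrite /height (@big_cat_nat _ _ _ x.+1 _ z) //= big_nat_recr //= zfx addn1.
apply: leq_trans (leq_addr _ _); rewrite ltnS.
rewrite !big_nat; apply: leq_sum => u /andP[_ ux].
case: (leqP x (f u)) => // xfu.
have fuN : f u < N by apply: fN; lia.
have n1 : u != f x by lia.
have n2 : f u != x by apply: (ncmatch_mate_neq nf) => //; lia.
have n3 : f u != f x by apply/eqP => e; move: (ff x xN) (ff u); rewrite e; lia.
have := nc x u xN; rewrite /side; lia.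
Qed.

(** Constancy on regions: taken at [x] and at its mate, the equation identifies
    the two gaps just outside an arc and the two gaps just inside it. *)
Definition consistent (N : nat) (f h : nat -> nat) : Prop :=
  forall x, x < N -> h (f x) = h x.+1.

Lemma height_consistent N f : ncmatch N f -> consistent N f (height f).
Proof.
move=> nf; have [fN ff fx nc] := nf.
have arc x : x < N -> x < f x -> height f (f x) = height f x.+1.
  move=> xN xfx; rewrite /height (@big_cat_nat _ _ _ x.+1 _ (f x)) //=.
  rewrite [X in _ + X]big_nat [X in _ + X]big1 ?addn0; last first.
    move=> u /andP[xu ufx]; have uN : u < N by have := fN x xN; lia.
    have n1 : u != x by lia.
    have n2 : u != f x by lia.
    have n3 : f u != x by apply: (ncmatch_mate_neq nf) => //.
    have n4 : f u != f x by apply/eqP => e; move: (ff x xN) (ff u uN); rewrite e; lia.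
    have := nc x u xN uN n1 n2; rewrite /side; lia.
  apply: eq_big_nat => u /andP[_ ux].
  case: (eqVneq u x) => [->|ne]; first by rewrite leqnn; lia.
  have uN : u < N by lia.
  have n2 : u != f x by lia.
  have n3 : f u != x by apply: (ncmatch_mate_neq nf) => //.
  have n4 : f u != f x by apply/eqP => e; move: (ff x xN) (ff u uN); rewrite e; lia.
  have := nc x u xN uN ne n2; rewrite /side; lia.
move=> x xN; have := fx x xN; case: (ltngtP (f x) x) => // lt _; last exact: arc.
have fxN := fN x xN.
have e1 := arc (f x) fxN; rewrite ff // in e1; move/(_ lt) in e1.
have := height_down nf xN lt; have := height_up nf fxN; rewrite ff // => /(_ lt).
by rewrite e1 => -> [].
Qed.

(** The arcs between the gaps [a] and [b] close among themselves, so the two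
    gaps lie in one region, and one can walk from arc to arc along its
    boundary. *)
Lemma region N (f h : nat -> nat) a b : ncmatch N f -> b <= N -> a <= b ->
  (forall x, a <= x < b -> (a <= f x < b) && (h (f x) == h x.+1)) -> h a = h b.
Proof.
move=> nf bN; have [fN ff fx nc] := nf.
move: {2}(b - a) (leqnn (b - a)) => s; elim: s a => [|s IH] a ss ab cl.
  by congr h; lia.
case: (eqVneq a b) => [->//|anb].
have aN : a < N by lia.
have /andP[/andP[afa fab] _] := cl a ltac:(lia).
have faa := fx a aN.
have faN := fN a aN.
have /andP[_ /eqP] := cl (f a) ltac:(lia); rewrite ff // => ->.
apply: IH => [||x xab]; [lia|lia|].
have xN : x < N by lia.
have /andP[c ->] := cl x ltac:(lia); rewrite andbT.
have n2 : f x != a by apply: (ncmatch_mate_neq nf) => //; lia.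
have n3 : f x != f a by apply/eqP => e; move: (ff x xN) (ff a aN); rewrite e; lia.
have := nc a x aN xN ltac:(lia) ltac:(lia); rewrite /side; lia.
Qed.

Lemma path_ext L k k' (h h' : nat -> nat) : is_path L k h -> is_path L k' h' ->
  (forall x, x < L -> (h x < h x.+1) = (h' x < h' x.+1)) ->
  forall x, x <= L -> h x = h' x.
Proof.
move=> [h0 _ st] [h0' _ st'] e; elim=> [|x IH] xL; first by rewrite h0 h0'.
have := IH (ltnW xL); have := st x xL; have := st' x xL; have := e x xL; lia.
Qed.

(** The openers determine the heights, and the mate of an opener is where the
    path first returns to the height it had there. *)
Lemma ncmatch_ext N f g : ncmatch N f -> ncmatch N g ->
  (forall x, x < N -> (x < f x) = (x < g x)) -> forall x, x < N -> f x = g x.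
Proof.
move=> nf ng op.
have [fN ff fx _] := nf; have [gN gg gx _] := ng.
have hh : forall x, x <= N -> height f x = height g x.
  apply: (path_ext (height_path nf) (height_path ng)) => x xN.
  by rewrite (height_ltE nf) // (height_ltE ng) // op.
have half f' g' : ncmatch N f' -> ncmatch N g' ->
   (forall x, x <= N -> height f' x = height g' x) ->
   forall x, x < N -> x < f' x -> x < g' x -> ~ (f' x < g' x).
  move=> nf' ng' hh' x xN xf xg lt.
  have [f'N ff' _ _] := nf'; have [g'N _ _ _] := ng'.
  have := height_under (z := (f' x).+1) ng' xN ltac:(lia) lt.
  rewrite -(hh' x (ltnW xN)) -(hh' _ (f'N x xN)).
  by have <- := height_consistent nf' (f'N _ xN); rewrite ff' // ltnn.
have opn x : x < N -> x < f x -> f x = g x.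
  move=> xN xf; have xg : x < g x by rewrite -op.
  have := half f g nf ng hh x xN xf xg.
  have := half g f ng nf (fun x xn => esym (hh x xn)) x xN xg xf; lia.
move=> x xN; have := fx x xN; case: (ltngtP (f x) x) => // lt _; last exact: opn.
have fxN := fN x xN.
by have := opn (f x) fxN; rewrite ff // => /(_ lt) {2}->; rewrite gg.
Qed.

Definition cupcap i f := rewire f i i.+1.

Lemma cupcap_ncmatch N f i : ncmatch N f -> i.+1 < N -> f i != i.+1 ->
  ncmatch N (cupcap i f).
Proof.
move=> nf iN fi; have [fN ff fx nc] := nf.
have i1 : f i.+1 != i by apply: (ncmatch_mate_neq nf) => //; [lia | lia].
apply: rewire_ncmatch => //; try lia.
  move=> z zN z1 z2 z3 z4.
  have : f z != i by apply: (ncmatch_mate_neq nf) => //; lia.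
  have : f z != i.+1 by apply: (ncmatch_mate_neq nf) => //; lia.
  rewrite /side; lia.
have := fx i; have := fx i.+1; rewrite /side; lia.
Qed.

(** Induction on the area under the path: a highest peak is lowered to a
    valley, and a generator applied at that valley restores the peak. *)
Lemma path_matching N (h : nat -> nat) : is_path N 0 h ->
  exists2 f, ncmatch N f & forall x, x < N -> (x < f x) = (h x < h x.+1).
Proof.
move: {2}(\sum_(x < N.+1) h x) (leqnn (\sum_(x < N.+1) h x)) => s.
elim: s h => [|s IH] h.
  rewrite leqn0 sum_nat_eq0 => /forallP hz [h0 hN st].
  case: N st hz {hN} => [|N] st hz.
    by exists id => //; split.
  have := st 0 isT; have := hz ord0; have := hz (inord 1).
  by rewrite /= !inordK //; lia.
move=> hs hp; have [h0 hN st] := hp.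
have [i /= mx] : exists i : 'I_N.+1, forall j : 'I_N.+1, h j <= h i.
  by case: (@arg_maxnP _ ord0 predT (fun i : 'I_N.+1 => h i)) => // i _ H; exists i => j; apply: H.
case: (leqP (h i) 1) => [hi|hi].
  (* the zigzag: each even point is joined to the next one *)
  have hodd x : x <= N -> h x = odd x.
    elim: x => [|x IHx] xN; first by rewrite h0.
    have := st x xN; have := IHx (ltnW xN); have := mx (Ordinal (xN : x.+1 < N.+1)).
    rewrite /= => ? ->; case: (odd x) => /=; lia.
  have eN : ~~ odd N by have := hodd N (leqnn N); rewrite hN; lia.
  exists (fun x => if odd x then x.-1 else x.+1); last first.
    by move=> x xN; rewrite !hodd ?(ltnW xN) //=; case: x xN => // x xN; case: (odd x.+1) => /=; lia.
  split=> [x xN|x xN|x xN|x z xN zN].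
  - case: ifP => // ox; first by lia.
    rewrite ltn_neqAle xN andbT; apply: contraNneq eN => <-.
    by rewrite /= ox.
  - case: x xN => // x _ /=; case ox: (odd x) => /=; last by rewrite ox.
    by rewrite negbK ox.
  - by case: ifP => ox; case: x xN ox => // x *; lia.
  - rewrite /side; case: ifP => ox; case: ifP => oz.
    + by case: x z xN zN ox oz => // x [|z] //= *; lia.
    + case: x xN ox => // x *; have : x != z by apply/eqP => e; subst; lia.
      lia.
    + case: z zN oz => // z *; lia.
    + lia.
have i0 : 0 < i by case: (posnP i) => // e; rewrite e h0 in hi.
have iN : i < N by have := ltn_ord i; rewrite ltnS leq_eqVlt => /orP[/eqP e|//]; rewrite e hN in hi.
(* the peak at [i] becomes a valley; its height is at least 2 *)
pose h' (x : nat) := if x == i :> nat then h i - 2 else h x.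
have hp1 : h i.-1 = (h i).-1.
  have := st i.-1; have := mx (inord i.-1); rewrite inordK; last by lia.
  rewrite prednK //; lia.
have hn1 : h i.+1 = (h i).-1.
  have := st i; have := mx (inord i.+1); rewrite inordK; last by lia.
  lia.
have hp' : is_path N 0 h'.
  split; rewrite /h'.
  - by rewrite ifN //; lia.
  - by rewrite ifN //; lia.
  - move=> m mN; have := st m mN.
    case: (eqVneq m (i : nat)) => [->|mi]; first by rewrite ifN; lia.
    case: (eqVneq m.+1 (i : nat)) => [e|mi1]; last by [].
    have -> : m = i.-1 by lia.
    lia.
have [|f nf opf] := IH h' _ hp'.
  rewrite (bigD1 i) //= {1}/h' eqxx.
  move: hs; rewrite (bigD1 i) //=.
  have -> : \sum_(j < N.+1 | j != i) h' j = \sum_(j < N.+1 | j != i) h j.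
    by apply: eq_bigr => j ji; rewrite /h' ifN.
  by move: hi; move: (h i) (\sum_(j < N.+1 | j != i) h j) => a b; lia.
have [fN ff fx nc] := nf.
have op1 : f i.-1 < i.-1.
  have := opf i.-1 ltac:(lia); have := fx i.-1 ltac:(lia).
  rewrite /h' prednK // eqxx ifN; lia.
have op2 : i < f i.
  by rewrite opf // /h' eqxx ifN; lia.
have dist : f i.-1 != i by lia.
have e : i.-1.+1 = i by lia.
have dist2 : f i != i.-1 by lia.
exists (cupcap i.-1 f); first by apply: cupcap_ncmatch => //; rewrite e.
move=> x xN; rewrite /cupcap /rewire e.
case: (eqVneq x i.-1) => [->|x1]; first by rewrite e; lia.
case: (eqVneq x (i : nat)) => [->|x2]; first by lia.
have hx' : (h' x < h' x.+1) = (h x < h x.+1) by rewrite /h' !ifN //; lia.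
rewrite -hx' -opf //.
case: (eqVneq x (f i.-1)) => [->|x3]; first by rewrite ff //; lia.
case: (eqVneq x (f i)) => [->|x4] //; first by rewrite ff //; lia.
Qed.

(** * State sums *)

(** Quantum integers: for [q = t + 1 / t] this is
    [(t ^ a - t ^ (- a)) / (t - 1 / t)]. *)
Fixpoint qnum (K : fieldType) (q : K) (a : nat) : K :=
  match a with
  | 0 => 0%R
  | 1 => 1%R
  | (b.+1 as c).+1 => (q * qnum q c - qnum q b)%R
  end.

Section StateSum.
Variables (K : fieldType) (q : K).
Hypothesis q_gen : forall a, qnum q a.+1 != 0%R.
Local Notation qn := (qnum q).

(** The weight of an arc with colour [a] outside and [b] inside.  Rising steps
    get weight 1, so that a diagram has state sum 1 at its own heights. *)
Definition step_weight (a b : nat) : K := if a < b then 1%R else (qn a / qn a.+1)%R.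

Definition arc_weight (h : nat -> nat) (x y : nat) : K :=
  if (h y == h x.+1) && (h y.+1 == h x) then step_weight (h x) (h x.+1) else 0%R.

Definition statesum (N : nat) (f h : nat -> nat) : K :=
  (\prod_(x < N | (x < f x)%N) arc_weight h x (f x))%R.

(** Whether [x] or [y] is the left end of an arc varies with the positions of
    the other arcs, so rewirings are best written with unordered ends. *)
Definition chord_weight h x y := arc_weight h (minn x y) (maxn x y).

Lemma chord_weightE h x y : x < y -> chord_weight h x y = arc_weight h x y.
Proof. by move=> lt; rewrite /chord_weight (minn_idPl _) ?(maxn_idPr _) // ltnW. Qed.

Lemma chord_weightC h x y : chord_weight h x y = chord_weight h y x.
Proof. by rewrite /chord_weight minnC maxnC. Qed.

(** The partial product over the arcs in [P].  For [P = four f a b] these are the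
    factors that a rewiring leaves alone. *)
Definition staterest (N : nat) (f : nat -> nat) (P : pred nat) (h : nat -> nat) : K :=
  (\prod_(x < N | (x < f x)%N && P x) arc_weight h x (f x))%R.

Lemma statesumE N f h : statesum N f h = staterest N f predT h.
Proof. by apply: eq_bigl => x; rewrite andbT. Qed.

Lemma staterest_pair N f (P : pred nat) h p : ncmatch N f -> p < N -> P p -> P (f p) ->
  staterest N f P h =
  (chord_weight h p (f p) * staterest N f (fun x => [&& P x, x != p & x != f p]) h)%R.
Proof.
move=> [fN ff fx _] pN Pp Pfp.
have gen x : x < N -> x < f x -> P x -> P (f x) -> staterest N f P h =
  (arc_weight h x (f x) * staterest N f (fun z => [&& P z, z != x & z != f x]) h)%R.
  move=> xN lt Px Pfx; rewrite /staterest (bigD1 (Ordinal xN)) ?lt //=; congr (_ * _)%R.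
  apply: eq_bigl => z; rewrite -(inj_eq val_inj) /=.
  case: (eqVneq (z : nat) x) => [->|zx] /=; first by rewrite !andbF.
  case: (eqVneq (z : nat) (f x)) => [->|//] /=; rewrite ?andbT //.
  by rewrite ff // !andbF ltnNge ltnW.
have := fx p pN; case: (ltngtP (f p) p) => // lt _; last first.
  by rewrite (gen p) // chord_weightE.
rewrite (gen (f p)) ?fN ?ff // chord_weightC chord_weightE //.
congr (_ * _)%R; apply: eq_bigl => z; by rewrite [(_ != f p) && _]andbC.
Qed.

Definition four (f : nat -> nat) a b : pred nat :=
  fun x => [&& x != a, x != b, x != f a & x != f b].

Lemma statesum4 N f h a b : ncmatch N f -> a < N -> b < N -> a != b -> f a != b ->
  statesum N f h =
  (chord_weight h a (f a) * chord_weight h b (f b) * staterest N f (four f a b) h)%R.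
Proof.
move=> nf aN bN ab fab; have [fN ff fx _] := nf.
rewrite statesumE (staterest_pair _ nf aN) // (@staterest_pair _ _ _ _ b) //.
- rewrite mulrA; congr (_ * _)%R; apply: eq_bigl => x; rewrite /four /=.
  by case: (_ != a); case: (_ != b); case: (_ != f a); case: (_ != f b).
- by rewrite /= [b == a]eq_sym ab eq_sym.
- rewrite /= (ncmatch_mate_neq nf) // 1?eq_sym //.
  by apply/eqP => e; move: ab; rewrite -(ff b bN) -(ff a aN) e eqxx.
Qed.

Lemma statesum_rewire N f h a b : ncmatch N f -> ncmatch N (rewire f a b) ->
  a < N -> b < N -> a != b -> f a != b ->
  statesum N (rewire f a b) h =
  (chord_weight h a b * chord_weight h (f a) (f b) * staterest N f (four f a b) h)%R.
Proof.
move=> nf nr aN bN ab fab; have [fN ff fx _] := nf.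
have fba : f b != a by apply: (ncmatch_mate_neq nf) => //; rewrite eq_sym.
have fafb : f a != f b by apply/eqP => e; move: ab; rewrite -(ff a aN) e ff // eqxx.
have ra : rewire f a b a = b by rewrite /rewire eqxx.
have rfa : rewire f a b (f a) = f b.
  by rewrite /rewire (negbTE (fx a aN)) (negbTE fab) eqxx.
rewrite (@statesum4 _ _ _ a (f a)) ?fN // ?ra ?rfa 1?eq_sym ?fx //; last first.
congr (_ * _)%R; rewrite /staterest; apply: eq_big => [x|x /andP[_]]; last first.
  by rewrite /four ra rfa => /and4P[? ? ? ?]; rewrite /rewire !ifN.
rewrite /four ra rfa.
case: (eqVneq (x : nat) a) => [|xa]; rewrite ?andbF //=.
case: (eqVneq (x : nat) (f a)) => [|xfa]; rewrite ?andbF //=.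
case: (eqVneq (x : nat) b) => [|xb]; rewrite ?andbF //=.
case: (eqVneq (x : nat) (f b)) => [|xfb]; rewrite ?andbF //=.
by rewrite /rewire !ifN.
Qed.

Lemma staterest_neq0 N f (P : pred nat) h x : ncmatch N f -> (forall x, x < N -> P x -> P (f x)) ->
  staterest N f P h != 0%R ->
  x < N -> P x -> h (f x) = h x.+1.
Proof.
move=> [fN ff fx _] Pf /prodf_neq0 nz xN Px.
have := fx x xN; case: (ltngtP (f x) x) => // lt _.
  have /= := nz (Ordinal (fN x xN)); rewrite ff // lt Pf // => /(_ isT).
  by rewrite /arc_weight; case: ifP => [/andP[_ /eqP]|]; rewrite ?eqxx.
have /= := nz (Ordinal xN); rewrite lt Px // => /(_ isT).
by rewrite /arc_weight; case: ifP => [/andP[/eqP]|]; rewrite ?eqxx.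
Qed.

Lemma statesum_neq0 N f h : ncmatch N f -> statesum N f h != 0%R -> consistent N f h.
Proof. by rewrite statesumE => nf nz x xN; apply: staterest_neq0 nz _ _. Qed.

Lemma four_closed N f a b x : ncmatch N f -> a < N -> b < N -> x < N -> 
   four f a b x -> four f a b (f x).
Proof.
move=> nf aN bN xN; have [fN ff _ _] := nf; rewrite /four => /and4P[xa xb xfa xfb].
rewrite !(ncmatch_mate_neq nf) //=.
- exact: fN.
- by rewrite ff.
- exact: fN.
- by rewrite ff.
Qed.

Lemma statesum_height N f : ncmatch N f -> statesum N f (height f) = 1%R.
Proof.
move=> nf; have [fN ff fx _] := nf; apply: big1 => x lt; rewrite /arc_weight.
rewrite (height_consistent nf) // eqxx /=.
have := height_consistent nf (fN x (ltn_ord x)); rewrite ff // => <-; rewrite eqxx.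
by rewrite /step_weight (height_ltE nf) // lt.
Qed.

(** The recursion of Jones and Wenzl as an identity between state sums.  The arc
    at [x] is the innermost one around the arc at [a].  If the heights rise at
    [x] and fall at [a], then they are consistent with [f] exactly when they are
    consistent with the rewired matching and rise at the mate of [a]; the
    weights then differ by the factor of a falling step. *)
Lemma statesum_exchange N f h x a : ncmatch N f ->
  x < a -> a < f a -> f a < f x -> f x < N ->
  (forall z, z < N -> z != x -> z != a -> z != f x -> z != f a ->
     side z (f z) x = side z (f z) a) ->
  (forall m, m < N -> h m.+1 = (h m).+1 \/ h m = (h m.+1).+1) ->
  h x.+1 = (h x).+1 ->
  (statesum N f h *+ (h a.+1 < h a)%N =
   qn (h a) / qn (h a).+1 * (statesum N (rewire f x a) h *+ (h (f a) < h (f a).+1)%N))%R.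
Proof.
move=> nf xa ab bc cN vis st hx; have [fN ff fx nc] := nf.
have xN : x < N by lia.
have aN : a < N by lia.
have ne : x != a by lia.
have fxa : f x != a by lia.
have nr : ncmatch N (rewire f x a).
  by apply: rewire_ncmatch => //; rewrite /side; lia.
rewrite (statesum_rewire _ nf nr) // (statesum4 _ nf xN aN) //.
set R := staterest _ _ _ _.
case: (eqVneq R 0%R) => [->|Rnz]; first by rewrite !mulr0 !mul0rn mulr0.
have clo z : z < N -> four f x a z -> h (f z) = h z.+1.
  by move=> zN; apply: (staterest_neq0 nf _ Rnz zN) => w; apply: four_closed.
have reg l r : l <= r -> r < N -> 
   (forall z, l <= z < r -> four f x a z && (l <= f z < r)) -> h l = h r.
  move=> lr rN H; apply: (region nf (ltnW rN) lr) => z zlr.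
  by have /andP[F ->] := H z zlr; rewrite clo ?eqxx //; lia.
have r1 : h x.+1 = h a.
  apply: reg => // z zi; have zN : z < N by lia.
  have F : four f x a z by rewrite /four; lia.
  rewrite F; have := four_closed nf xN aN zN F; move: F; rewrite /four => /and4P[*].
  have := vis z zN; have := nc x z xN zN; have := nc a z aN zN; rewrite /side; lia.
have r2 : h a.+1 = h (f a).
  apply: reg => //; first by lia. move=> z zi; have zN : z < N by lia.
  have F : four f x a z by rewrite /four; lia.
  rewrite F; have := four_closed nf xN aN zN F; move: F; rewrite /four => /and4P[*].
  have := vis z zN; have := nc x z xN zN; have := nc a z aN zN; rewrite /side; lia.
have r3 : h (f a).+1 = h (f x).
  apply: reg => // z zi; have zN : z < N by lia.
  have F : four f x a z by rewrite /four; lia.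
  rewrite F; have := four_closed nf xN aN zN F; move: F; rewrite /four => /and4P[*].
  have := vis z zN; have := nc x z xN zN; have := nc a z aN zN; rewrite /side; lia.
rewrite (@chord_weightE h x (f x)) 1?(@chord_weightE h a (f a)) 1?(@chord_weightE h x a) 1?(chord_weightC h (f x)) 1?(@chord_weightE h (f a)) //; try lia.
rewrite /arc_weight.
have sa := st a aN; have sfa := st (f a) (fN a aN).
move: sa sfa; rewrite -r3 -r2 -r1 hx.
move: (h x) (h a.+1) (h (f a).+1) (h (f x).+1) => e p d g; rewrite eqxx !andTb.
case: (eqVneq p e) => [-> _ sd|pe [->|[/esym/eqP]]]; last 1 first.
- by rewrite (negbTE pe).
- rewrite [d == e.+1]eq_sym; case: (eqVneq d e.+1) => [->|de]; last first.
    have -> : (e < d) = false by lia.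
    by rewrite /= !mul0r mulr0n mulr0 mul0rn.
  have nlt : (e.+1 < e) = false by lia.
  by rewrite eqxx !andTb ?andbT /step_weight ltnSn nlt; case: (g == e); rewrite ?mul0r ?mulr0 ?mul1r ?mul0rn ?mulr0 ?mulr1n ?mul0r ?mulr0.
- have nlt : (e.+2 < e.+1) = false by lia.
  by rewrite nlt andbF !mulr0n !mul0r mul0rn mulr0.
Qed.

Definition set_height (h : nat -> nat) (i b : nat) : nat -> nat :=
  fun m => if m == i then b else h m.

(** Weights of a cap with colour [a] outside, for the two colours that its
    inside may have.  At [a = 0] there is no smaller colour. *)
Definition capdown (a : nat) : K := (if a is 0 then 0 else 1)%R.
Definition capup (a : nat) : K := (qn a.+2 / qn a.+1)%R.

(** The generator at the points [i] and [i.+1] as an operator on functions of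
    paths: a cap sums over the height between the two points, and a cup puts a
    new height there. *)
Definition gen_op (i : nat) (F : (nat -> nat) -> K) (h : nat -> nat) : K :=
  if h i == h i.+2 then
    (step_weight (h i) (h i.+1) * (capup (h i) * F (set_height h i.+1 (h i).+1) +
                           capdown (h i) * F (set_height h i.+1 (h i).-1)))%R
  else 0%R.

Lemma qnumS a : (q * qn a.+1 = qn a.+2 + qn a)%R.
Proof. by rewrite /= subrK. Qed.

(** A loop, summed over the colours of its inside, contributes [q]. *)
Lemma loop_weight a :
  (capup a * step_weight a a.+1 + capdown a * step_weight a a.-1 = q)%R.
Proof.
rewrite /capup /step_weight ltnSn mulr1.
have -> : (capdown a * (if (a < a.-1)%N then 1 else qn a / qn a.+1) = qn a / qn a.+1)%R.
  by case: a => [|a]; rewrite /capdown ?mul0r ?mul0r // mul1r ltnNge leqnSn.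
by rewrite -mulrDl -qnumS mulfK.
Qed.

(** The cap weight as a function of the colour inside; [capwK] says that it
    straightens a bent line. *)
Definition capw a o : K := if a < o then capup a else capdown a.

Lemma capwK a o : o = a.+1 \/ a = o.+1 -> (capw a o * step_weight o a = 1)%R.
Proof.
rewrite /capw /step_weight => -[->|->]; rewrite ltnSn ltnNge leqnSn /=.
  by rewrite /capup mulrA mulfVK // divff.
by rewrite mulr1.
Qed.

Lemma cap_pick a o (G : nat -> K) : o = a.+1 \/ a = o.+1 ->
  (forall b, b != o -> G b = 0%R) ->
  (capup a * G a.+1 + capdown a * G a.-1 = capw a o * G o)%R.
Proof.
move=> eo G0; rewrite /capw; case: eo G0 => -> G0.
  by rewrite ltnSn (G0 a.-1) ?mulr0 ?addr0 //; lia.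
by rewrite ltnNge leqnSn /= (G0 o.+2) ?mulr0 ?add0r //; lia.
Qed.

Lemma set_height_st N h i b : 
  (forall m, m < N -> h m.+1 = (h m).+1 \/ h m = (h m.+1).+1) ->
  i.+1 < N -> h i = h i.+2 -> b = (h i).+1 \/ h i = b.+1 ->
  (forall m, m < N -> set_height h i.+1 b m.+1 = (set_height h i.+1 b m).+1 \/ set_height h i.+1 b m = (set_height h i.+1 b m.+1).+1).
Proof.
move=> st iN e eb m mN; rewrite /set_height eqSS.
case: (eqVneq m i) => [->|mi]; first by rewrite ltn_eqF //; lia.
case: (eqVneq m i.+1) => [->|mi1]; first by lia.
exact: st.
Qed.

Lemma staterest_set_height N f (P : pred nat) h i b : ncmatch N f -> (forall x, x < N -> P x -> P (f x)) ->
  ~~ P i -> ~~ P i.+1 -> staterest N f P (set_height h i.+1 b) = staterest N f P h.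
Proof.
move=> nf Pf Pi Pi1; apply: eq_bigr => x /andP[_ Px]; have xN := ltn_ord x.
have Pfx := Pf x xN Px.
have n z : P z -> (z == i.+1 = false) * (z.+1 == i.+1 = false).
  by move=> Pz; rewrite eqSS; split; apply: contraTF Pz => /eqP ->.
by rewrite /arc_weight /set_height !(n _ Px) !(n _ Pfx).
Qed.

Lemma statesum_cupcap_loop N f h i : ncmatch N f -> i.+1 < N -> f i = i.+1 ->
  (q * statesum N f h = gen_op i (statesum N f) h)%R.
Proof.
move=> nf iN fi; have [fN ff fx nc] := nf.
pose P := fun x => [&& predT x, x != i & x != f i].
have e g : statesum N f g = (chord_weight g i i.+1 * staterest N f P g)%R.
  by rewrite statesumE (@staterest_pair N f predT g i nf (ltnW iN)) // {1}fi.
have Pf x : x < N -> P x -> P (f x).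
  move=> xN /and3P[_ xi xfi]; rewrite /P /= (ncmatch_mate_neq nf xN (ltnW iN)) //=.
  by apply: (ncmatch_mate_neq nf xN (fN i (ltnW iN))); rewrite ff // ltnW.
have ni : ~~ P i by rewrite /P eqxx andbF.
have ni1 : ~~ P i.+1 by rewrite /P fi eqxx !andbF.
rewrite /gen_op !e !(staterest_set_height _ _ nf Pf ni ni1) !mulrA -mulrDl.
rewrite !(@chord_weightE _ i i.+1) // /arc_weight /set_height !eqxx.
have e1 : (i.+2 == i.+1) = false by lia.
have e2 : (i == i.+1) = false by lia.
rewrite e1 e2 !andTb [h i.+2 == _]eq_sym.
case: eqP => [E|_]; rewrite ?mulr0 ?mul0r ?mulr0 ?mul0r //.
by rewrite -(loop_weight (h i)) mulrA [X in (X * _)%R = _]mulrC.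
Qed.

(** Of the two heights that the cap sums over, only the colour of the region
    beyond the joined line is consistent.  There the cap cancels the weight of
    one of the two old arcs, leaving that of their union.  The cases are the
    positions that the two mates can have. *)
Lemma statesum_cupcap N f h i : ncmatch N f -> i.+1 < N -> f i != i.+1 ->
  (forall m, m < N -> h m.+1 = (h m).+1 \/ h m = (h m.+1).+1) ->
  statesum N (cupcap i f) h = gen_op i (statesum N f) h.
Proof.
move=> nf iN fi st; have [fN ff fx nc] := nf.
have iN' : i < N by lia.
have nr : ncmatch N (rewire f i i.+1) by apply: cupcap_ncmatch.
have ne : i != i.+1 by lia.
rewrite /cupcap (statesum_rewire _ nf nr) // /gen_op !(statesum4 _ nf iN' iN) //.
pose P := four f i i.+1.
have Pf x : x < N -> P x -> P (f x) := four_closed nf iN' iN.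
have ni : ~~ P i by rewrite /P /four eqxx.
have ni1 : ~~ P i.+1 by rewrite /P /four eqxx andbF.
rewrite !(staterest_set_height _ _ nf Pf ni ni1) -/P.
set R := staterest _ _ _ _.
case: (eqVneq R 0%R) => [->|Rnz]; first by case: ifP; rewrite !(mulr0, addr0).
have clo z : z < N -> P z -> h (f z) = h z.+1.
  by move=> zN; apply: (staterest_neq0 nf _ Rnz zN).
have reg l r : l <= r -> r < N ->
   (forall z, l <= z < r -> P z && (l <= f z < r)) -> h l = h r.
  move=> lr rN H; apply: (region nf (ltnW rN) lr) => z zlr.
  by have /andP[F ->] := H z zlr; rewrite clo ?eqxx //; lia.
have e1 : (i.+2 == i.+1) = false by lia.
have e2 : (i == i.+1) = false by lia.
have u0 b : set_height h i.+1 b i = h i by rewrite /set_height e2.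
have u1 b : set_height h i.+1 b i.+1 = b by rewrite /set_height eqxx.
have uo b z : z != i.+1 -> set_height h i.+1 b z = h z by rewrite /set_height => /negbTE ->.
have [fiN fi1N] := (fN i iN', fN i.+1 iN).
have fii := fx i iN'; have fi1 := fx i.+1 iN.
have fi1i : f i.+1 != i by apply: (ncmatch_mate_neq nf) => //; rewrite eq_sym.
have side_i := nc i i.+1 iN' iN.
have fifi : f i != f i.+1 by apply/eqP => e; move: (ff i iN'); rewrite e ff //; lia.
have ins z : z < N -> P z ->
   (side i (f i) z = side i (f i) (f z)) *
   (side i.+1 (f i.+1) z = side i.+1 (f i.+1) (f z)) * P (f z).
  move=> zN Pz; have := Pf z zN Pz; move: (Pz); rewrite /P /four => /and4P[? ? ? ?] ->.
  by rewrite !(nc _ z).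
have PE z : P z = [&& z != i, z != i.+1, z != f i & z != f i.+1] by [].
rewrite [chord_weight h i i.+1]chord_weightE // {1}/arc_weight eqxx andTb [h i.+2 == _]eq_sym.
case: (eqVneq (h i) (h i.+2)) => [hi2|_]; last by rewrite !mul0r.
rewrite -[LHS]mulrA; congr (_ * _)%R.
pose G b := (chord_weight (set_height h i.+1 b) i (f i) * chord_weight (set_height h i.+1 b) i.+1 (f i.+1) * R)%R.
case: (ltnP (f i) i) => xi; last (have {}xi : i.+1 < f i by lia).
  have rx : h (f i).+1 = h i.
    apply: reg => // z zi; have zN : z < N by lia.
    have Pz : P z by rewrite PE; move: side_i; rewrite /side; lia.
    rewrite Pz; have [[]] := ins z zN Pz; rewrite PE /side; lia.
  case: (ltnP (f i.+1) i) => yi; last (have {}yi : i.+1 < f i.+1 by lia).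
    (* f i.+1 < f i < i *)
    have yx : f i.+1 < f i by move: side_i; rewrite /side; lia.
    have eo : h (f i) = (h i).+1 \/ h i = (h (f i)).+1 by have := st _ fiN; lia.
    rewrite [RHS](cap_pick (G := G) eo); last first.
      move=> b bo; rewrite /G [chord_weight _ i _]chord_weightC chord_weightE // /arc_weight u0 u1 !uo; try lia.
      by rewrite (negbTE bo) andbF !mul0r.
    have ry : h (f i.+1).+1 = h (f i).
      apply: reg => // z zi; have zN : z < N by lia.
      have Pz : P z by rewrite PE; lia.
      rewrite Pz; have [[]] := ins z zN Pz; rewrite PE /side; lia.
    rewrite /G [chord_weight _ i _]chord_weightC [chord_weight _ i.+1 _]chord_weightC [chord_weight _ (f i) _]chord_weightC !chord_weightE //; last by lia.
    rewrite /arc_weight u0 u1 !uo; try lia.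
    rewrite rx ry !eqxx /= -hi2; case: (h i == h (f i.+1)); last by rewrite !(mul0r, mulr0).
    rewrite -[LHS]mul1r -(capwK eo). ring.
  (* f i < i < i.+1 < f i.+1 *)
  have ry : h i.+2 = h (f i.+1).
    apply: reg => // z zi; have zN : z < N by lia.
    have Pz : P z by rewrite PE; lia.
    rewrite Pz; have [[]] := ins z zN Pz; rewrite PE /side; lia.
  have eo : h (f i) = (h i).+1 \/ h i = (h (f i)).+1 by have := st _ fiN; lia.
  rewrite [RHS](cap_pick (G := G) eo); last first.
    move=> b bo; rewrite /G [chord_weight _ i _]chord_weightC chord_weightE // /arc_weight u0 u1 !uo; try lia.
    by rewrite (negbTE bo) andbF !mul0r.
  rewrite /G [chord_weight _ i _]chord_weightC !chord_weightE //; last by lia.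
  rewrite /arc_weight u0 u1 !uo; try lia.
  rewrite rx -ry hi2 !eqxx /=; case: (_ == h (f i)); last by rewrite !(mul0r, mulr0).
  rewrite -?hi2 -[LHS]mul1r -(capwK eo). ring.
(* i.+1 < f i.+1 < f i *)
have yx : i.+1 < f i.+1 < f i by move: side_i; rewrite /side; lia.
have ry : h i.+2 = h (f i.+1).
  apply: reg => [||z zi]; [lia|lia|]; have zN : z < N by lia.
  have Pz : P z by rewrite PE; lia.
  rewrite Pz; have [[]] := ins z zN Pz; rewrite PE /side; lia.
have eo : h (f i.+1).+1 = (h i).+1 \/ h i = (h (f i.+1).+1).+1 by have := st _ fi1N; lia.
have yi1 : i.+1 < f i.+1 by lia.
have yx1 : f i.+1 < f i by lia.
rewrite [RHS](cap_pick (G := G) eo); last first.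
  move=> b bo; rewrite /G [chord_weight _ i.+1 _]chord_weightE // /arc_weight u1 !uo; try lia.
  by rewrite [_ == b]eq_sym (negbTE bo) andbF !(mul0r, mulr0).
rewrite /G [chord_weight _ (f i) _]chord_weightC !chord_weightE //; last by lia.
rewrite /arc_weight u0 u1 !uo; try lia.
rewrite -ry hi2 !eqxx /=; case: (_ && _); last by rewrite !(mul0r, mulr0).
rewrite -?hi2 -[LHS]mul1r -(capwK eo). ring.
Qed.
End StateSum.

(** * Diagrams, and two-colourings of their stacks *)

Section Diagrams.
Variable n : nat.
Implicit Types (d : diagram n) (p : point n).

Definition pt (i : 'I_(n + n)) : point n :=
  match fintype.split i with inl j => inl j | inr j => inr (rev_ord j) end.

Lemma pos_lt p : pos p < n + n.
Proof. by case: p => i /=; have := ltn_ord i; lia. Qed.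

Lemma ptK i : pos (pt i) = i.
Proof.
rewrite /pt; case: splitP => j -> //=.
by have := ltn_ord j; lia.
Qed.

Lemma pos_inj : injective (@pos n).
Proof.
move=> [i|i] [j|j] /= e; have := ltn_ord i; have := ltn_ord j => ? ?; try lia.
  by congr inl; apply: val_inj.
by congr inr; apply: val_inj => /=; lia.
Qed.

Lemma posK p (lt : pos p < n + n) : pt (Ordinal lt) = p.
Proof. by apply: pos_inj; rewrite ptK. Qed.

Definition mate d (x : nat) : nat :=
  if insub x is Some i then pos (val d (pt i)) else x.

Lemma mate_pos d p : mate d (pos p) = pos (val d p).
Proof. by rewrite /mate insubT ?pos_lt // => lt; rewrite posK. Qed.

Lemma pos_surj x : x < n + n -> exists p, x = pos p.
Proof. by move=> lt; exists (pt (Ordinal lt)); rewrite ptK. Qed.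

Lemma mate_ncmatch d : ncmatch (n + n) (mate d).
Proof.
have /andP[/forallP mm /forallP nc] := valP d.
have dd p : val d (val d p) = p by have /andP[/eqP] := mm p.
have dp p : val d p != p by have /andP[] := mm p.
split=> [x /pos_surj[p ->]|x /pos_surj[p ->]|x /pos_surj[p ->]|x z].
- by rewrite mate_pos pos_lt.
- by rewrite !mate_pos dd.
- by rewrite mate_pos (inj_eq pos_inj).
move=> /pos_surj[p ->] /pos_surj[r ->]; rewrite !mate_pos !(inj_eq pos_inj) => rp rdp.
have n1 : pos r != pos p by rewrite (inj_eq pos_inj).
have n2 : pos r != pos (val d p) by rewrite (inj_eq pos_inj).
have n3 : pos (val d r) != pos p.
  by rewrite (inj_eq pos_inj); apply: contraNneq rdp => <-; rewrite dd.
have n4 : pos (val d r) != pos (val d p).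
  by rewrite (inj_eq pos_inj); apply: contraNneq rp => e; rewrite -(dd r) e dd.
have cr u v : ~~ crossing (val d) u v by have /forallP := nc u.
have := cr p r; have := cr p (val d r); have := cr (val d p) r.
have := cr (val d p) (val d r); have := cr r p; have := cr r (val d p).
have := cr (val d r) p; have := cr (val d r) (val d p).
rewrite /crossing /side !dd; move: n1 n2 n3 n4; clear.
by move: (pos p) (pos r) (pos (val d p)) (pos (val d r)) => a b a' b'; lia.
Qed.

Lemma mate_inj d d' : (forall x, x < n + n -> mate d x = mate d' x) -> d = d'.
Proof.
move=> e; apply: val_inj; apply/ffunP => p; apply: pos_inj.
by rewrite -!mate_pos e // pos_lt.
Qed.

(** The diagram [d] is the value when [f] is not a non-crossing matching. *)
Definition of_fun d (f : nat -> nat) : diagram n :=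
  insubd d [ffun p => odflt p (omap pt (insub (f (pos p))))].

Lemma ncmatch_is_diagram f : ncmatch (n + n) f ->
  is_diagram [ffun p => odflt p (omap pt (insub (f (pos p))))].
Proof.
move=> [fN ff fx nc]; set d := finfun _.
have dE p : pos (d p) = f (pos p).
  by rewrite ffunE insubT /= ?fN ?pos_lt // => lt; rewrite ptK.
apply/andP; split.
  apply/forallP => p; rewrite -!(inj_eq pos_inj) !dE ff ?pos_lt ?eqxx //=.
  by rewrite fx ?pos_lt.
apply/forallP => p; apply/forallP => r; rewrite /crossing !dE.
have := nc (pos p) (pos r) (pos_lt p) (pos_lt r); rewrite /side.
have := ff (pos r) (pos_lt r).
case: (eqVneq (pos r) (f (pos p))) => [->|]; first by rewrite ltnn andbF.
lia.
Qed.

Lemma of_funK d f : ncmatch (n + n) f ->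
  forall x, x < n + n -> mate (of_fun d f) x = f x.
Proof.
move=> nf x /pos_surj[p ->]; rewrite mate_pos /of_fun insubdK ?ffunE; last first.
  exact: ncmatch_is_diagram.
have [fN _ _ _] := nf.
by rewrite insubT /= ?fN ?pos_lt // => lt; rewrite ptK.
Qed.

Lemma ncmatch_diagram f : ncmatch (n + n) f ->
  exists d, forall x, x < n + n -> mate d x = f x.
Proof.
move=> nf; exists (eqtype.Sub _ (ncmatch_is_diagram nf) : diagram n).
move=> x /pos_surj[p ->]; rewrite mate_pos SubK ffunE.
have [fN _ _ _] := nf.
by rewrite insubT /= ?fN ?pos_lt // => lt; rewrite ptK.
Qed.

Definition rewired d a b := of_fun d (rewire (mate d) a b).

(** The diagram of a generator times [d].  If [d] joins the two points, this is
    [d] itself, and the loop has to be counted separately. *)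
Definition gen_act i d := rewired d i i.+1.

Lemma gen_act_mate i d : i.+1 < n + n -> 
  forall x, x < n + n -> mate (gen_act i d) x = rewire (mate d) i i.+1 x.
Proof.
move=> iN; apply: of_funK; have nf := mate_ncmatch d.
case: (eqVneq (mate d i) i.+1) => [e|ne]; last exact: cupcap_ncmatch.
have [_ ff _ _] := nf; have e' : mate d i.+1 = i by rewrite -e ff // ltnW.
have E x : rewire (mate d) i i.+1 x = mate d x.
  rewrite /rewire e e'; case: eqP => [->//|]; case: eqP => [->//|//].
case: nf => fN _ fx nc.
by split=> [x|x|x|x z]; rewrite !E //; [exact: fN|exact: ff|exact: fx|exact: nc].
Qed.

Lemma gen_act_loop i d : i.+1 < n + n -> mate d i = i.+1 -> gen_act i d = d.
Proof.
move=> iN e; apply: mate_inj => x xN; rewrite gen_act_mate //.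
have [_ ff _ _] := mate_ncmatch d.
have e' : mate d i.+1 = i by rewrite -e ff // ltnW.
rewrite /rewire e e'; case: eqP => [->//|]; case: eqP => [->//|//].
Qed.

(** Colouring lines with two colours is a representation at loop value 2 in
    which stacking is visibly matrix multiplication.  It serves to compute
    concatenations and loops without following paths in a stack. *)
Definition row_colours := {ffun 'I_n -> bool}.
Definition colour (a b : row_colours) p : bool := match p with inl i => a i | inr i => b i end.
Definition agrees d (a b : row_colours) : bool :=
  [forall p, colour a b (val d p) == colour a b p].

Definition set_colours (i j : 'I_n) (c : bool) (a : row_colours) : row_colours :=
  [ffun k => if (k == i) || (k == j) then c else a k].

(** The generator in this representation: its cup forces the new points to
    agree, its cap sums over their common former colour. *)
Definition gen_colour (i j : 'I_n) (F : row_colours -> nat) (a : row_colours) : nat :=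
  if a i == a j then F (set_colours i j true a) + F (set_colours i j false a) else 0.

Lemma mateV d p : val d (val d p) = p.
Proof. by have /andP[/forallP /(_ p) /andP[/eqP]] := valP d. Qed.

Lemma mate_neq d p : val d p != p.
Proof. by have /andP[/forallP /(_ p) /andP[]] := valP d. Qed.

Lemma gen_act_val (i j : 'I_n) d p : j = i.+1 :> nat ->
  val (gen_act i d) p =
   if p == inl i then inl j else if p == inl j then inl i else
   if p == val d (inl i) then val d (inl j) else
   if p == val d (inl j) then val d (inl i) else val d p.
Proof.
move=> ij; apply: pos_inj; rewrite -mate_pos gen_act_mate ?pos_lt //; last first.
  by have := ltn_ord j; lia.
have pi : pos (inl i : point n) = i by [].
have pj : pos (inl j : point n) = i.+1 by [].
by rewrite /rewire -pj -pi !mate_pos !(inj_eq pos_inj) !(fun_if (@pos n)).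
Qed.

Lemma agrees_gen_act_loop (i j : 'I_n) d a b : j = i.+1 :> nat -> mate d i = i.+1 ->
  2 * agrees d a b = gen_colour i j (fun a => agrees d a b) a.
Proof.
move=> ij dij; have {dij} di : val d (inl i) = inl j.
  by apply: pos_inj; rewrite -mate_pos /= dij.
have dj : val d (inl j) = inl i by rewrite -di mateV.
rewrite /gen_colour; case: eqP => [e|ne]; last first.
  case: (boolP (agrees d a b)) => // /forallP /(_ (inl i)).
  by rewrite di /= => /eqP e; case: ne.
suff E c : agrees d (set_colours i j c a) b = agrees d a b by rewrite !E mul2n addnn.
have iE p : (p == inl i :> point n) = (val d p == inl j).
  by rewrite -(can_eq (mateV d)) di.
have jE p : (p == inl j :> point n) = (val d p == inl i).
  by rewrite -(can_eq (mateV d)) dj.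
have cE c' p : colour (set_colours i j c' a) b p =
  if (p == inl i) || (p == inl j) then c' else colour a b p.
  by case: p => k //=; rewrite ffunE.
apply: eq_forallb => p; rewrite !cE (iE p) (jE p) orbC.
case: ifP => // /orP[]/eqP H; rewrite eqxx.
  by rewrite -{2}[p](mateV d) H dj /= e eqxx.
by rewrite -{2}[p](mateV d) H di /= e eqxx.
Qed.

Lemma agrees_gen_act (i j : 'I_n) d a b : j = i.+1 :> nat -> mate d i != i.+1 ->
  (agrees (gen_act i d) a b : nat) = gen_colour i j (fun a => agrees d a b) a.
Proof.
move=> ij dij; set x := val d (inl i); set y := val d (inl j).
have xj : x != inl j.
  by apply: contraNneq dij => e; rewrite (mate_pos d (inl i)) -/x e /= ij.
have xi : x != inl i by apply: mate_neq.
have yj : y != inl j by apply: mate_neq.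
have yi : y != inl i.
  by apply: contraNneq xj => e; rewrite /x -e /y mateV.
have xy : x != y.
  apply/eqP => /(congr1 (val d)); rewrite !mateV => -[] /(congr1 val) /=; lia.
pose rest a' := [forall p, [&& p != inl i, p != inl j, p != x & p != y] ==>
   (colour a' b (val d p) == colour a' b p)].
have dE a' : agrees d a' b =
  [&& colour a' b x == a' i, colour a' b y == a' j & rest a'].
  apply/forallP/and3P => [H|[/eqP e1 /eqP e2 /forallP H] p].
    split; [exact: (H (inl i))|exact: (H (inl j))|].
    by apply/forallP => p; apply/implyP.
  have := H p; case: (eqVneq p (inl i)) => [->|_]; first by rewrite -/x e1.
  case: (eqVneq p (inl j)) => [->|_]; first by rewrite -/y e2.
  case: (eqVneq p x) => [->|_]; first by rewrite /x mateV -/x e1.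
  by case: (eqVneq p y) => [->|_] //; rewrite /y mateV -/y e2.
have cE a' : agrees (gen_act i d) a' b =
  [&& a' i == a' j, colour a' b x == colour a' b y & rest a'].
  apply/forallP/and3P => [H|[/eqP e1 /eqP e2 /forallP H] p].
    split.
    - by have := H (inl i); rewrite (gen_act_val _ _ ij) eqxx /= eq_sym.
    - have := H x; rewrite (gen_act_val _ _ ij) (negbTE xi) (negbTE xj) eqxx.
      by rewrite eq_sym.
    apply/forallP => p; apply/implyP => /and4P[p1 p2 p3 p4].
    by have := H p; rewrite (gen_act_val _ _ ij) !ifN.
  have := H p; rewrite (gen_act_val _ _ ij).
  case: (eqVneq p (inl i)) => [->|_]; first by rewrite /= e1.
  case: (eqVneq p (inl j)) => [->|_]; first by rewrite /= e1.
  case: (eqVneq p x) => [->|_]; first by rewrite -/y e2.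
  by case: (eqVneq p y) => [->|_] //; rewrite -/x e2.
rewrite /gen_colour cE; case: eqP => //= _.
have colE c p : p != inl i -> p != inl j -> colour (set_colours i j c a) b p = colour a b p.
  by case: p => k //= ki kj; rewrite ffunE ifN // negb_or; apply/andP.
have restE c : rest (set_colours i j c a) = rest a.
  apply: eq_forallb => p; case: and4P => //= -[p1 p2 p3 p4].
  rewrite !colE //.
    by apply: contraNneq p3 => e; rewrite /x -e mateV.
  by apply: contraNneq p4 => e; rewrite /y -e mateV.
rewrite !dE !restE !colE // !ffunE !eqxx orbT /=.
by case: (rest a); case: (colour a b x); case: (colour a b y).
Qed.

Definition stack_colour (a b c : row_colours) (v : stack_point n) : bool :=
  match v with inl (inl i) => a i | inl (inr i) => b i | inr i => c i end.

Lemma stack_colour_connect d e a b c u v : agrees d a b -> agrees e b c ->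
  connect (stack_edge d e) u v -> stack_colour a b c u = stack_colour a b c v.
Proof.
move=> /forallP Hd /forallP He /connectP[s].
elim: s u => [|w s IH] u /=; first by move=> _ ->.
move=> /andP[uw sw] lw; rewrite -(IH w) // {s IH sw lw v}.
have cu p : stack_colour a b c (upper p) = colour a b p by case: p.
have cl p : stack_colour a b c (lower p) = colour b c p by case: p.
case/orP: uw => /existsP[p /andP[/eqP-> /eqP->]].
  by rewrite !cu; apply/esym/eqP.
by rewrite !cl; apply/esym/eqP.
Qed.

Lemma stack_edge_sym d e : symmetric (stack_edge d e).
Proof.
suff H u v : stack_edge d e u v -> stack_edge d e v u by move=> u v; apply/idP/idP; apply: H.
case/orP => /existsP[p /andP[/eqP-> /eqP->]]; apply/orP; [left|right]; apply/existsP.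
  by exists (val d p); rewrite mateV !eqxx.
by exists (val e p); rewrite mateV !eqxx.
Qed.

Lemma stack_colour_invariant d e (F : stack_point n -> bool) :
  (forall u v, stack_edge d e u v -> F u = F v) ->
  agrees d [ffun i => F (inl (inl i))] [ffun i => F (inl (inr i))] &&
  agrees e [ffun i => F (inl (inr i))] [ffun i => F (inr i)].
Proof.
move=> HF.
have cu p : colour [ffun i => F (inl (inl i))] [ffun i => F (inl (inr i))] p = F (upper p).
  by case: p => i /=; rewrite ffunE.
have cl p : colour [ffun i => F (inl (inr i))] [ffun i => F (inr i)] p = F (lower p).
  by case: p => i /=; rewrite ffunE.
apply/andP; split; apply/forallP => p; rewrite ?cu ?cl; apply/eqP/esym/HF/orP.
  by left; apply/existsP; exists p; rewrite !eqxx.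
by right; apply/existsP; exists p; rewrite !eqxx.
Qed.

Definition colourings d e (a c : row_colours) : nat :=
  \sum_(b : row_colours) (agrees d a b * agrees e b c).

Lemma stack_colour_outer a b c p : stack_colour a b c (outer p) = colour a c p.
Proof. by case: p. Qed.

(** Colour one connected component of the stack true and all else false: this
    is a colouring, so [f] agrees with the outer colours, and cannot join a
    point of the component to a point outside it. *)
Lemma colourings_concatenation d e f l :
  (forall a c, colourings d e a c = 2 ^ l * agrees f a c) ->
  concatenation d e f.
Proof.
move=> H; apply/forallP => p; set E := stack_edge d e.
(* the indicator of one component *)
pose F v := connect E (outer p) v.
have cs : connect_sym E by apply/sym_connect_sym/stack_edge_sym.
have HF u v : E u v -> F u = F v.
  by move=> uv; rewrite /F; apply/(same_connect_r cs)/connect1.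
have /andP[a1 a2] := stack_colour_invariant HF.
move: a1 a2; set a := finfun _; set b := finfun _; set c := finfun _ => a1 a2.
have : 0 < colourings d e a c by rewrite /colourings (bigD1 b) //= a1 a2.
rewrite H; case: (boolP (agrees f a c)) => [/forallP /(_ p)|_]; last by rewrite muln0.
have cF r : colour a c r = F (outer r) by case: r => i /=; rewrite ffunE.
by rewrite !cF {2}/F connect0 => /eqP.
Qed.

(** Colour the two ends of a line of [f] true and the other outer points false.
    This extends to the stack, where colours are constant on components. *)
Lemma colourings_unique d e f l g :
  (forall a c, colourings d e a c = 2 ^ l * agrees f a c) ->
  concatenation d e g -> g = f.
Proof.
move=> H /forallP cg; apply: val_inj; apply/ffunP => p.
apply: contraTeq isT => gp.
pose F r := (r == p) || (r == val f p).
pose a : row_colours := [ffun i => F (inl i)]; pose c : row_colours := [ffun i => F (inr i)].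
have cF r : colour a c r = F r by case: r => i /=; rewrite ffunE.
have af : agrees f a c.
  apply/forallP => r; rewrite !cF /F (can_eq (mateV f)).
  by rewrite -[val f r == p](can_eq (mateV f)) mateV orbC.
have : 0 < colourings d e a c by rewrite H af muln1 expn_gt0.
rewrite /colourings lt0n sum_nat_eq0 => /forallPn[b].
rewrite implyTb muln_eq0 negb_or !eqb0 !negbK => /andP[a1 a2].
have := stack_colour_connect a1 a2 (cg p).
by rewrite !stack_colour_outer !cF /F eqxx /= (negbTE gp) (negbTE (mate_neq g p)).
Qed.

(** If all outer points are coloured false, a colouring of the stack amounts to
    a set of closed loops. *)
Lemma colourings_loops d e f l :
  (forall a c, colourings d e a c = 2 ^ l * agrees f a c) -> loops d e = l.
Proof.
move=> H; set E := stack_edge d e.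
have cs : connect_sym E by apply/sym_connect_sym/stack_edge_sym.
pose z : row_colours := [ffun=> false].
have zz : agrees f z z by apply/forallP => p; case: (val f p) => i; case: p => j; rewrite /= !ffunE.
have := H z z; rewrite zz muln1.
pose R := [set v | roots E v && [forall p : point n, ~~ connect E v (outer p)]].
pose B := [set b : row_colours | agrees d z b && agrees e b z].
have -> : colourings d e z z = #|B|.
  rewrite -sum1_card big_mkcond /=; apply: eq_bigr => b _; rewrite inE mulnb.
  by case: (_ && _).
have -> : loops d e = #|R| by rewrite /loops /n_comp_mem; apply: eq_card => v; rewrite !inE.
pose G (T : {set stack_point n}) : row_colours := [ffun i => fingraph.root E (inl (inr i)) \in T].
have -> : B = G @: powerset R.
  apply/setP => b; rewrite inE; apply/idP/imsetP => [/andP[a1 a2]|[T]]; last first.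
    rewrite inE => TR ->.
    pose F v := fingraph.root E v \in T.
    have HF u v : E u v -> F u = F v.
      by move=> uv; rewrite /F (elimT (fingraph.rootP cs) (connect1 uv)).
    have oF p : F (outer p) = false.
      apply/negP => /(fintype.subsetP TR); rewrite inE => /andP[_ /forallP /(_ p)].
      by rewrite cs connect_root.
    have := stack_colour_invariant HF.
    suff [-> ->] : [ffun i => F (inl (inl i))] = z /\ [ffun i => F (inr i)] = z by [].
    by split; apply/ffunP => i; rewrite !ffunE; [exact: (oF (inl i))|exact: (oF (inr i))].
  (* the loops coloured true *)
  exists [set v in R | stack_colour z b z v]; first by rewrite inE; apply/fintype.subsetP => v; rewrite inE => /andP[].
  apply/ffunP => i; rewrite ffunE !inE roots_root //=.
  have <- : stack_colour z b z (inl (inr i)) = b i by [].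
  have -> := stack_colour_connect a1 a2 (connect_root E (inl (inr i))).
  set r := fingraph.root E _.
  case: (boolP [forall p, _]) => //= /forallPn[p]; rewrite negbK => rp.
  by rewrite (stack_colour_connect a1 a2 rp) stack_colour_outer; case: p {rp} => j; rewrite /= ffunE.
rewrite card_in_imset ?card_powerset; first by move/eqP; rewrite eqn_exp2l // => /eqP.
move=> T T'; rewrite !inE => TR TR' /ffunP eT; apply/setP => v.
have aux : v \in R -> (v \in T) = (v \in T').
  rewrite inE => /andP[/eqP rv /forallP nov].
  case: v rv nov => [[i|i]|i] rv nov.
  - by have := nov (inl i); rewrite connect0.
  - by have := eT i; rewrite !ffunE rv.
  - by have := nov (inr i); rewrite connect0.
apply/idP/idP => vT; first by rewrite -aux // (fintype.subsetP TR).
by rewrite aux // (fintype.subsetP TR').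
Qed.

End Diagrams.

(** * Generation by cups *)

Definition column (n x : nat) : nat := if x < n then x else (n + n).-1 - x.
Definition gap (a b : nat) : nat := (a - b) + (b - a).

(** Zero for the identity diagram; peeling off a generator decreases it. *)
Definition displacement (n : nat) (f : nat -> nat) : nat :=
  \sum_(x < n + n) gap (column n x) (column n (f x)).

Lemma path_parity L k (h : nat -> nat) m : is_path L k h -> m <= L -> odd (h m) = odd m.
Proof.
move=> [h0 _ st]; elim: m => [|m IH] mL; first by rewrite h0.
have := IH (ltnW mL); have [->|->] /= := st m mL => [->//|<-]; by rewrite negbK.
Qed.

Lemma column_le n i x : i < n -> x < n + n ->
  (column n x <= i) = (x <= i) || (n + n <= x + i.+1).
Proof. by rewrite /column; case: (ltnP x n); lia. Qed.

(** The vertical line to the right of column [i] is crossed by an even number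
    of arcs, hence not only by the cup.  Otherwise the points to its right,
    without [i.+1], would be matched among themselves; then [region] equates
    two heights at positions of different parity. *)
Lemma second_crossing n f i : ncmatch (n + n) f -> i.+1 < n -> f i = i.+1 ->
  exists2 x, x < n + n & (x != i) && (column n x <= i < column n (f x)).
Proof.
move=> nf iN fi; have [fN ff fx nc] := nf.
pose ok (x : 'I_(n + n)) := (x != i :> nat) && (column n x <= i < column n (f x)).
case: (pickP ok) => [x okx|no]; first by exists x.
have iN2 : i < n + n by lia.
have hp := height_path nf.
have R : height f i.+2 = height f ((n + n).-1 - i).
  apply: (@region (n + n) f) => // [||z zi]; [lia|lia|].
  have zN : z < n + n by lia.
  rewrite (height_consistent nf) // eqxx andbT.
  have := no (Ordinal (fN z zN)); rewrite /ok /= ff // /column.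
  have := fN z zN; have n1 : f z != i by apply: (ncmatch_mate_neq nf) => //; lia.
  have n2 : f z != i.+1 by rewrite -fi; apply: (ncmatch_mate_neq nf) => //; [lia|rewrite ff //; lia].
  by case: (ltnP z n); case: (ltnP (f z) n); lia.
have p1 : odd (height f i.+2) = odd i.+2 by apply: (path_parity hp); lia.
have p2 : odd (height f ((n + n).-1 - i)) = odd ((n + n).-1 - i).
  by apply: (path_parity hp); lia.
move: p1; rewrite R p2.
have -> : (n + n).-1 - i = (n - i.+1).*2 + i.+1 by lia.
by rewrite oddD odd_double /=; case: (odd i).
Qed.

(** Following the vertical line downwards from the cup, the first arc met
    bounds the same region as the cup. *)
Lemma nearest_crossing n f i : ncmatch (n + n) f -> i.+1 < n -> f i = i.+1 ->
  exists x, [/\ x < n + n, x != i, column n x <= i < column n (f x) &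
   forall z, z < n + n -> z != i -> z != x -> z != i.+1 -> z != f x ->
     side z (f z) i = side z (f z) x].
Proof.
move=> nf iN fi; have [fN ff fx nc] := nf.
have iN2 : i < n + n by lia.
have [x0 x0N ok0] := second_crossing nf iN fi.
pose ok (x : 'I_(n + n)) := (x != i :> nat) && (column n x <= i < column n (f x)).
(* the order of the points left of the line: along the top row from the cup to
   the corner, then along the bottom row *)
pose depth x := if x <= i then i - x else i + (n + n - x).
have [x /andP[xi okx] mx] := @arg_minnP _ (Ordinal x0N) ok (fun x => depth x) ok0.
have xN := ltn_ord x.
exists x; split=> // z zN zi zx zi1 zfx.
have n1 : f z != i by apply: (ncmatch_mate_neq nf) => //; rewrite fi.
have n2 : f z != i.+1 by rewrite -fi; apply: (ncmatch_mate_neq nf) => //; [lia|rewrite ff //; lia].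
have n3 : f z != x by apply: (ncmatch_mate_neq nf).
have n4 : f z != f x.
  by apply: (ncmatch_mate_neq nf) => //; rewrite ?ff // fN.
have := nc x z xN zN zx zfx.
have := mx (Ordinal zN); rewrite /ok /depth /= !ltnNge !column_le ?(ltnW iN) ?fN //.
have := mx (Ordinal (fN z zN)); rewrite /ok /depth /= ff // !ltnNge !column_le ?(ltnW iN) ?fN //.
have yN := fN x xN; have wN := fN z zN.
move: okx; rewrite !ltnNge !column_le ?(ltnW iN) //.
move: n1 n2 n3 n4 xi zi zi1 zx zfx xN zN yN wN; rewrite /side; clear -iN.
move: (f x) (f z) => y w; move: (nat_of_ord x) => x1.
case: (leqP x1 i) => ?; case: (leqP z i) => ?; case: (leqP w i) => ?; lia.
Qed.

Lemma sum_four (N : nat) (F : nat -> nat) a b c d : uniq [:: a; b; c; d] ->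
  a < N -> b < N -> c < N -> d < N ->
  \sum_(x < N) F x = F a + (F b + (F c + (F d +
     \sum_(x < N | (x : nat) \notin [:: a; b; c; d]) F x))).
Proof.
move=> /= /and4P[] ab ac ad _ aN bN cN dN.
move: ab ac ad; rewrite !inE !negb_or => /and3P[ab ac ad] /andP[bc bd] cd.
rewrite (bigD1 (Ordinal aN)) // (bigD1 (Ordinal bN)) /=; last by rewrite -val_eqE /= eq_sym.
rewrite (bigD1 (Ordinal cN)) /=; last by rewrite -!val_eqE /= ![c == _]eq_sym ac.
rewrite (bigD1 (Ordinal dN)) /=; last by rewrite -!val_eqE /= ![d == _]eq_sym ad bd.
congr (_ + (_ + (_ + (_ + _)))); apply: eq_bigl => x.
by rewrite -!val_eqE /= !inE !negb_or -!andbA.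
Qed.

(** Joining the cup to the arc below it gives a diagram from which the generator
    restores [f].  Each new arc stays on one side of the vertical line that
    the old ones crossed, so together they are shorter. *)
Lemma cup_peel n f i : ncmatch (n + n) f -> i.+1 < n -> f i = i.+1 ->
  exists x, [/\ ncmatch (n + n) (rewire f i x), rewire f i x i != i.+1,
     (forall z, z < n + n -> rewire (rewire f i x) i i.+1 z = f z) &
     displacement n (rewire f i x) < displacement n f].
Proof.
move=> nf iN fi; have [fN ff fx nc] := nf.
have [x [xN xi cx vis]] := nearest_crossing nf iN fi.
have iN2 : i < n + n by lia.
have fi1 : f i.+1 = i by rewrite -fi ff.
have xi1 : x != i.+1 by move: cx; rewrite /column; case: ifP; lia.
have yi : f x != i by apply: (ncmatch_mate_neq nf) => //; rewrite fi.
have yi1 : f x != i.+1.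
  by rewrite -fi; apply: (ncmatch_mate_neq nf) => //; rewrite ?fN ?ff.
have yx := fx x xN; have yN := fN x xN.
have ri : rewire f i x i = x by rewrite /rewire eqxx.
have rx : rewire f i x x = i by rewrite /rewire eqxx (negbTE xi).
have ri1 : rewire f i x i.+1 = f x.
  by rewrite /rewire fi eqxx ![i.+1 == _]eq_sym (negbTE xi1) ltn_eqF.
have ry : rewire f i x (f x) = i.+1.
  by rewrite /rewire (negbTE yi) (negbTE yx) fi (negbTE yi1) eqxx.
have ro z : z != i -> z != x -> z != i.+1 -> z != f x -> rewire f i x z = f z.
  by move=> *; rewrite /rewire fi !ifN.
exists x; split.
- apply: rewire_ncmatch => //; try by rewrite ?fi // eq_sym.
  rewrite fi; move: cx; rewrite /side /column; case: (ltnP x n); case: (ltnP (f x) n); lia.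
- by rewrite ri.
- move=> z zN; rewrite {1}/rewire ri ri1.
  case: (eqVneq z i) => [->|z1]; first by rewrite fi.
  case: (eqVneq z i.+1) => [->|z2]; first by rewrite fi1.
  case: (eqVneq z x) => [->|z3] //.
  case: (eqVneq z (f x)) => [->|z4]; first by rewrite ff.
  by rewrite ro.
have un : uniq [:: i; i.+1; x; f x].
  rewrite /= !inE !negb_or ![i == _]eq_sym ![i.+1 == _]eq_sym xi xi1 yi yi1 [x == _]eq_sym yx !andbT.
  by rewrite ?(gtn_eqF (ltnSn i)) ?(ltn_eqF (ltnSn i)).
rewrite /displacement.
rewrite (@sum_four _ (fun z => gap (column n z) (column n (rewire f i x z))) _ _ _ _ un) //; try lia.
rewrite (@sum_four _ (fun z => gap (column n z) (column n (f z))) _ _ _ _ un) //; try lia.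
rewrite ri ri1 rx ry fi fi1 ff //.
set S := (X in _ + (_ + (_ + (_ + X))) < _); set S' := (X in _ < _ + (_ + (_ + (_ + X)))).
have -> : S = S'.
  by apply: eq_bigr => z; rewrite !inE !negb_or => /and4P[? ? ? ?]; rewrite ro.
have ci : column n i = i by rewrite /column ltnW.
have ci1 : column n i.+1 = i.+1 by rewrite /column iN.
by rewrite ci ci1 /gap; move: cx; lia.
Qed.

Lemma innermost_cup n f x : ncmatch (n + n) f -> x < f x -> f x < n ->
  exists2 i, i.+1 < n & f i = i.+1.
Proof.
move=> nf; have [fN ff fx nc] := nf.
move: {2}(f x - x) (leqnn (f x - x)) => s; elim: s x => [|s IH] x; first by lia.
move=> ss xf fn; case: (eqVneq (f x) x.+1) => [e|ne]; first by exists x => //; rewrite -e.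
have xN : x < n + n by lia.
have x1N : x.+1 < n + n by lia.
have n1 : f x.+1 != x by apply: (ncmatch_mate_neq nf) => //; rewrite eq_sym.
have n2 : f x.+1 != f x.
  by apply: (ncmatch_mate_neq nf) => //; rewrite ?ff ?fN //; lia.
have := nc x x.+1 xN x1N ltac:(lia) ltac:(lia); have := fx x.+1 x1N.
by rewrite /side => ? ?; apply: (IH x.+1); lia.
Qed.

Lemma id_ncmatch n : ncmatch (n + n) (fun x => (n + n).-1 - x).
Proof. by split=> [x|x|x|x z]; rewrite /side; lia. Qed.

(** The heights have to climb to [n] along the top row, so they can only fall
    along the bottom row. *)
Lemma mate_id n f : ncmatch (n + n) f -> (forall x, x < n -> f x >= n) ->
  forall x, x < n + n -> f x = (n + n).-1 - x.
Proof.
move=> nf top; apply: (ncmatch_ext nf (id_ncmatch n)) => x xN.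
rewrite -(height_ltE nf) //; have [h0 hN st] := height_path nf.
have up m : m <= n -> height f m = m.
  elim: m => [//|m IH] mn; rewrite (height_up nf) ?IH //; try lia.
  by have := top m mn; lia.
have low j : n <= height f (n + j) + j \/ n + n < n + j.
  elim: j => [|j IH]; first by rewrite addn0 up //; lia.
  case: (leqP (n + n) (n + j)) => ?; first by right; lia.
  by have := st (n + j) ltac:(lia); rewrite !addnS; lia.
have hi j : j <= n -> height f (n + n - j) <= j.
  elim: j => [|j IH] jn; first by rewrite subn0 hN.
  have := st (n + n - j.+1) ltac:(lia); have -> : (n + n - j.+1).+1 = n + n - j by lia.
  by have := IH (ltnW jn); lia.
case: (ltnP x n) => xn; first by rewrite !up //; lia.
have := low (x - n); have := low (x.+1 - n).
have := hi (n + n - x) ltac:(lia); have := hi (n + n - x.+1) ltac:(lia).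
rewrite !subnKC //; try lia.
have -> : n + n - (n + n - x) = x by lia.
have -> : n + n - (n + n - x.+1) = x.+1 by lia.
lia.
Qed.

(** The generators generate: induction on the displacement, peeling off an
    innermost cup of the top row. *)
Lemma diagram_cup_ind n (P : diagram n -> Prop) :
  (forall d, is_id_diagram d -> P d) ->
  (forall d i, i.+1 < n -> mate d i != i.+1 -> P d -> P (gen_act i d)) ->
  forall d, P d.
Proof.
move=> Pid Pcup d.
have [s] := ubnP (displacement n (mate d)); elim: s d => // s IH d ds.
have nf := mate_ncmatch d.
case: (boolP [exists x : 'I_(n + n), (x < mate d x) && (mate d x < n)]) => [|nx].
  case/existsP => x /andP[xf fn].
  have [i iN fi] := innermost_cup nf xf fn.
  have [y [nr ri re lt]] := cup_peel nf iN fi.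
  pose d' := rewired d i y.
  have iN2 : i.+1 < n + n by lia.
  have md : forall z, z < n + n -> mate d' z = rewire (mate d) i y z.
    by apply: of_funK.
  have -> : d = gen_act i d'.
    apply: mate_inj => z zN; rewrite gen_act_mate //.
    have [rN _ _ _] := nr.
    by rewrite -re // {1 3}/rewire !md // ltnW.
  apply: Pcup => //; first by rewrite md // ltnW.
  apply: IH; have -> : displacement n (mate d') = displacement n (rewire (mate d) i y).
    by apply: eq_bigr => z _; rewrite md.
  by lia.
apply: Pid; apply/forallP => j; apply/eqP/pos_inj; rewrite -mate_pos /=.
have xn := ltn_ord j.
rewrite (mate_id nf) //; last by lia.
move=> x xn'; rewrite leqNgt; apply/negP => fn; case/negP: nx; apply/existsP.
have xN : x < n + n by lia.
have [fN ff fx _] := nf; have := fx x xN.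
case: (ltngtP (mate d x) x) => // lt _.
  by exists (Ordinal (fN x xN)); rewrite /= ff // lt.
by exists (Ordinal xN); rewrite /= lt.
Qed.

(** * Matrix entries *)

Section Paths.
Variable n : nat.

Definition pfun (P : {ffun 'I_n.+1 -> 'I_n.+1}) (m : nat) : nat := P (inord m).

Definition pathb (k : nat) (P : {ffun 'I_n.+1 -> 'I_n.+1}) : bool :=
  [&& pfun P 0 == 0, pfun P n == k &
    [forall i : 'I_n, (pfun P i.+1 == (pfun P i).+1) || (pfun P i == (pfun P i.+1).+1)]].

(** The index set of the [k]-th irreducible representation. *)
Definition hpath (k : nat) : finType := {P : {ffun 'I_n.+1 -> 'I_n.+1} | pathb k P}.

Definition hfun k (P : hpath k) : nat -> nat := pfun (val P).

Lemma hfun_path k (P : hpath k) : is_path n k (hfun P).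
Proof.
have /and3P[/eqP p0 /eqP pn /forallP st] := valP P.
by split=> // m mn; have /orP[/eqP|/eqP] := st (Ordinal mn); [left|right].
Qed.

Lemma hfun_inj k (P P' : hpath k) : (forall m, m <= n -> hfun P m = hfun P' m) -> P = P'.
Proof.
move=> e; apply: val_inj; apply/ffunP => i; apply: val_inj.
by have := e i (leq_ord i); rewrite /hfun /pfun !inord_val.
Qed.

Lemma hpath_of k h : is_path n k h ->
  exists P : hpath k, forall m, m <= n -> hfun P m = h m.
Proof.
move=> hp; pose P := [ffun i : 'I_n.+1 => inord (h i) : 'I_n.+1].
have PE m : m <= n -> pfun P m = h m.
  move=> mn; rewrite /pfun ffunE !inordK //.
  by rewrite ltnS (leq_trans (is_path_le hp mn)) .
have bP : pathb k P.
  have [h0 hn st] := hp; rewrite /pathb !PE // h0 hn !eqxx /=.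
  apply/forallP => i; rewrite !PE //; last exact: ltnW.
  by have [->|->] := st i (ltn_ord i); rewrite eqxx ?orbT.
by exists (eqtype.Sub P bP).
Qed.

(** The path that runs along [P] and returns along [Q], in the clockwise order
    of the boundary points. *)
Definition glue (P Q : nat -> nat) (m : nat) : nat :=
  if m <= n then P m else Q (n + n - m).

Lemma glue_right k (P Q : nat -> nat) m : is_path n k P -> is_path n k Q ->
  m <= n -> glue P Q (n + n - m) = Q m.
Proof.
move=> [_ pn _] [_ qn _] mn; rewrite /glue; case: leqP => [le|_]; last by congr Q; lia.
have -> : m = n by lia.
by rewrite addnK pn qn.
Qed.

Lemma glue_path k P Q : is_path n k P -> is_path n k Q -> is_path (n + n) 0 (glue P Q).
Proof.
move=> hP hQ; have [p0 pn sp] := hP; have [q0 qn sq] := hQ.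
have gl m : m <= n -> glue P Q m = P m by rewrite /glue => ->.
split; first by rewrite gl.
  by rewrite -[X in glue _ _ X]subn0 (glue_right hP hQ) // q0.
move=> m mN; case: (ltnP m n) => mn; first by rewrite !gl ?(ltnW mn) //; apply: sp.
have jn : n + n - m.+1 < n by lia.
have := sq _ jn; rewrite -(glue_right hP hQ (ltnW jn)) -(glue_right hP hQ jn).
have -> : n + n - (n + n - m.+1).+1 = m by lia.
have -> : n + n - (n + n - m.+1) = m.+1 by lia.
lia.
Qed.

Lemma unglue h : is_path (n + n) 0 h ->
  is_path n (h n) h /\ is_path n (h n) (fun m => h (n + n - m)).
Proof.
move=> [h0 hN st]; split; first by split=> // m mn; apply: st; lia.
split; [by rewrite subn0|by rewrite addnK|move=> m mn].
have := st (n + n - m.+1) ltac:(lia).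
have -> : (n + n - m.+1).+1 = n + n - m by lia.
lia.
Qed.

Lemma glue_unglue h m : m <= n + n -> glue h (fun m => h (n + n - m)) m = h m.
Proof. by move=> mN; rewrite /glue; case: leqP => // _; congr h; lia. Qed.

End Paths.

Section Entries.
Variables (K : fieldType) (q : K).
Hypothesis q_gen : forall a, qnum q a.+1 != 0%R.
Variable n : nat.
Implicit Types (d : diagram n) (P Q : nat -> nat).

(** Bending the bottom row up multiplies the entry in column [Q] by this factor:
    it turns the weight of a cap into that of a bent arc, and gives a through
    line the weight of an arc. *)
Definition scale Q : K := (\prod_(i < n) step_weight q (Q i) (Q i.+1))%R.

Definition entry d P Q : K :=
  (statesum q (n + n) (mate d) (glue n P Q) / scale Q)%R.

Lemma step_weight_neq0 a b : b = a.+1 \/ a = b.+1 -> step_weight q a b != 0%R.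
Proof.
by rewrite /step_weight => -[]->; rewrite ?ltnSn ?oner_neq0 // ltnNge leqnSn mulf_neq0 ?invr_eq0.
Qed.

Lemma scale_neq0 k Q : is_path n k Q -> scale Q != 0%R.
Proof. by move=> [_ _ st]; apply/prodf_neq0 => i _; apply/step_weight_neq0/st. Qed.

Lemma statesum_ext N f h h' : ncmatch N f -> (forall m, m <= N -> h m = h' m) ->
  statesum q N f h = statesum q N f h'.
Proof.
move=> [fN _ _ _] e; apply: eq_bigr => x _; have xN := ltn_ord x.
by rewrite /arc_weight !e // ?fN // ltnW // fN.
Qed.

Lemma entry_ext d P P' Q Q' : (forall m, m <= n -> P m = P' m) ->
  (forall m, m <= n -> Q m = Q' m) -> entry d P Q = entry d P' Q'.
Proof.
move=> eP eQ; rewrite /entry; congr (_ / _)%R; last first.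
  by apply: eq_bigr => i _; rewrite !eQ // ltnW.
apply: statesum_ext (mate_ncmatch d) _ => m mN; rewrite /glue.
by case: leqP => ?; [apply: eP|apply: eQ; lia].
Qed.

Lemma mate_is_id d x : is_id_diagram d -> x < n + n -> mate d x = (n + n).-1 - x.
Proof.
move=> /forallP idd; apply: (mate_id (mate_ncmatch d)) => {}x xn.
have := idd (Ordinal xn) => /eqP e.
by rewrite -[x]/(pos (inl (Ordinal xn) : point n)) mate_pos e /=; lia.
Qed.

(** For the identity diagram, consistency means that the two halves of the path
    coincide, and the state sum is then the scale. *)
Lemma entry_id d k P Q : is_id_diagram d -> is_path n k P -> is_path n k Q ->
  entry d P Q = [forall m : 'I_n.+1, P m == Q m]%:R%R.
Proof.
move=> idd hP hQ; have sQ := scale_neq0 hQ.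
have nd := mate_ncmatch d.
have mE x : x < n -> mate d x = (n + n).-1 - x by move=> xn; apply: mate_is_id => //; lia.
have gl x : x <= n -> glue n P Q x = P x by rewrite /glue => ->.
have gr x : x < n -> glue n P Q ((n + n).-1 - x) = Q x.+1.
  move=> xn; rewrite -(glue_right hP hQ xn); congr (glue _ _ _ _); lia.
have gr' x : x < n -> glue n P Q ((n + n).-1 - x).+1 = Q x.
  move=> xn; rewrite -(glue_right hP hQ (ltnW xn)); congr (glue _ _ _ _); lia.
case: forallP => [e|ne]; rewrite /entry; last first.
  have [->|nz] := eqVneq (statesum q (n + n) (mate d) (glue n P Q)) 0%R; first by rewrite mul0r.
  case: ne => m; have c := statesum_neq0 nd nz.
  have mn : m <= n by rewrite -ltnS.
  move: mn; case: (nat_of_ord m) => [|x] xn.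
    by have [-> _ _] := hP; have [-> _ _] := hQ.
  have := c x ltac:(lia); rewrite mE // gr // gl // => ->; exact: eqxx.
rewrite -[RHS](divff sQ); congr (_ / _)%R.
rewrite /statesum (eq_bigl (fun x : 'I_(n + n) => (x < n)%N)); last first.
  by move=> x; rewrite mate_is_id //; have := ltn_ord x; lia.
rewrite big_ord_narrow //= ?leq_addr // => le.
apply: eq_bigr => i _ /=; have iN := ltn_ord i.
rewrite mE // /arc_weight gr // gr' // !gl ?(ltnW iN) //.
have PQ m : m <= n -> P m = Q m by move=> mn; apply/eqP; exact: (e (Ordinal (mn : m < n.+1))).
by rewrite !PQ ?(ltnW iN) // !eqxx.
Qed.

Lemma entry_gen_act d i k P Q : i.+1 < n -> is_path n k P -> is_path n k Q ->
  ((if mate d i == i.+1 then q else 1) * entry (gen_act i d) P Q)%R =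
  gen_op q i (fun P => entry d P Q) P.
Proof.
move=> iN hP hQ; have iN2 : i.+1 < n + n by lia.
have nd := mate_ncmatch d.
have -> : gen_op q i (fun P => entry d P Q) P =
   (gen_op q i (statesum q (n + n) (mate d)) (glue n P Q) / scale Q)%R.
  have [g0 g1] : (i <= n) /\ (i < n) by lia.
  rewrite /gen_op /entry /glue g0 g1 iN.
  case: ifP => _; last by rewrite mul0r.
  have E b : statesum q (n + n) (mate d) (fun m => if m <= n then set_height P i.+1 b m else Q (n + n - m)) =
             statesum q (n + n) (mate d) (set_height (fun m => if m <= n then P m else Q (n + n - m)) i.+1 b).
    apply: statesum_ext nd _ => m _; rewrite /set_height.
    by case: (eqVneq m i.+1) => [->|//]; rewrite (ltnW iN).
  by rewrite !E !mulrA -mulrDl !mulrA.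
case: eqP => [e|/eqP ne].
  by rewrite gen_act_loop // /entry mulrA (statesum_cupcap_loop q_gen _ nd iN2 e).
rewrite mul1r /entry; congr (_ / _)%R.
rewrite -(statesum_cupcap q_gen) //; last by have [] := glue_path hP hQ.
rewrite /statesum; apply: eq_big => x; first by rewrite gen_act_mate.
by move=> _; rewrite gen_act_mate.
Qed.

End Entries.

(** * Products of diagrams *)

Section Product.
Variables (K : fieldType) (q : K).
Hypothesis q_gen : forall a, qnum q a.+1 != 0%R.
Variable n : nat.
Implicit Types (d e : diagram n) (P Q : nat -> nat).

Lemma set_height_path k P i b : is_path n k P -> i.+1 < n -> P i = P i.+2 ->
  b = (P i).+1 \/ P i = b.+1 -> is_path n k (set_height P i.+1 b).
Proof.
move=> [p0 pn st] iN e eb; split.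
- by rewrite /set_height.
- by rewrite /set_height gtn_eqF.
- exact: set_height_st.
Qed.

Lemma gen_op_eq i k F G P : is_path n k P -> i.+1 < n ->
  (forall P', is_path n k P' -> F P' = G P') -> gen_op q i F P = gen_op q i G P.
Proof.
move=> hP iN e; rewrite /gen_op; case: eqP => // eqi; congr (_ * (_ * _ + _))%R.
  by apply: e; apply: set_height_path => //; left.
rewrite /capdown; case E : (P i) => [|a]; first by rewrite !mul0r.
by congr (_ * _)%R; apply: e; apply: set_height_path => //; right; rewrite E.
Qed.

Lemma gen_op_sum (I : finType) i (F : I -> (nat -> nat) -> K) (c : I -> K) P :
  (\sum_x gen_op q i (F x) P * c x)%R = gen_op q i (fun P => \sum_x F x P * c x)%R P.
Proof.
rewrite /gen_op; case: ifP => _; last by rewrite big1 // => x _; rewrite mul0r.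
rewrite !mulr_sumr -big_split /= mulr_sumr; apply: eq_bigr => x _; ring.
Qed.

Lemma gen_op_scale i F (c : K) P :
  gen_op q i (fun P => c * F P)%R P = (c * gen_op q i F P)%R.
Proof. by rewrite /gen_op; case: ifP => _; [ring|rewrite mulr0]. Qed.

Lemma gen_colour_sum (I : finType) (i j : 'I_n) (F : I -> row_colours n -> nat) (c : I -> nat) a :
  \sum_x gen_colour i j (F x) a * c x = gen_colour i j (fun a => \sum_x F x a * c x) a.
Proof.
rewrite /gen_colour; case: ifP => _; last by rewrite big1.
by rewrite -big_split; apply: eq_bigr => x _; rewrite mulnDl.
Qed.

Lemma gen_colour_ext (i j : 'I_n) F G a : (forall a, F a = G a) -> gen_colour i j F a = gen_colour i j G a.
Proof. by move=> e; rewrite /gen_colour !e. Qed.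

Lemma gen_colour_scale (i j : 'I_n) F (c : nat) a :
  gen_colour i j (fun a => c * F a) a = c * gen_colour i j F a.
Proof. by rewrite /gen_colour; case: ifP => _; rewrite ?muln0 // mulnDr. Qed.

(** A generator acts on the top row of [d], and so commutes with the sum over
    the middle row, in the colouring model as well as in the path model. *)
Lemma diagram_product d e : exists f, exists l,
  (forall a c, colourings d e a c = 2 ^ l * agrees f a c) /\
  (forall k P Q, is_path n k P -> is_path n k Q ->
    (\sum_(X : hpath n k) entry q d P (hfun X) * entry q e (hfun X) Q =
     q ^+ l * entry q f P Q)%R).
Proof.
elim/diagram_cup_ind: d => [d idd|d i iN di [f [l [Hc Hp]]]].
  exists e, 0; split=> [a c|k P Q hP hQ].
    have aE b : agrees d a b = (b == a).
      move/forallP: idd => idd.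
      apply/forallP/eqP => [H|-> p].
        by apply/ffunP => i; have := H (inl i); rewrite (eqP (idd i)) => /eqP.
      have idr j : val d (inr j) = inl j by rewrite -(eqP (idd j)) mateV.
      by case: p => j; rewrite ?idr ?(eqP (idd j)) /=.
    rewrite /colourings (bigD1 a) //= aE eqxx big1 ?addn0 // => b /negbTE.
    by rewrite aE => ->.
  have [X XE] := hpath_of hP.
  rewrite (bigD1 X) //= big1 ?addr0 => [|Y YX].
    rewrite (entry_id q_gen idd hP (hfun_path X)).
    have -> : [forall m : 'I_n.+1, P m == hfun X m].
      by apply/forallP => m; rewrite XE // -ltnS.
    rewrite mul1r expr0 mul1r; exact: entry_ext.
  rewrite (entry_id q_gen idd hP (hfun_path Y)).
  case: forallP => [H|_]; last by rewrite mul0r.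
  case/eqP: YX; apply: hfun_inj => m mn.
  by rewrite XE //; apply/esym/eqP; apply: (H (Ordinal (mn : m < n.+1))).
pose i0 := Ordinal (ltnW iN); pose j0 := Ordinal iN.
exists (gen_act i f), (l + (mate f i == i.+1)); split=> [a c|k P Q hP hQ].
  rewrite /colourings.
  under eq_bigr => b _ do rewrite (@agrees_gen_act _ i0 j0) //.
  rewrite gen_colour_sum (gen_colour_ext _ _ _ (G := fun a => 2 ^ l * agrees f a c)) => [|a']; last exact: Hc.
  rewrite gen_colour_scale expnD -mulnA; congr (_ * _).
  case: eqP => [e1|/eqP ne1].
    by rewrite (gen_act_loop _ e1) ?(agrees_gen_act_loop _ _ (i := i0) (j := j0)) //; lia.
  by rewrite mul1n (@agrees_gen_act _ i0 j0).
under eq_bigr => X _.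
  have := entry_gen_act q_gen d iN hP (hfun_path X); rewrite (negbTE di) mul1r => ->.
  over.
rewrite gen_op_sum (@gen_op_eq _ k _ (fun P => q ^+ l * entry q f P Q)%R) //; last first.
  by move=> P' hP'; apply: Hp.
rewrite gen_op_scale -(entry_gen_act q_gen f iN hP hQ) mulrA exprD.
by case: eqP => _; rewrite ?expr1 ?expr0.
Qed.

End Product.

(** * The fast transform *)

Section Updates.
Variables (K : fieldType) (I : finType).

Definition update (f : {ffun I -> K}) (t : K * I * I) : {ffun I -> K} :=
  [ffun z => if z == t.2 then (f z + t.1.1 * f t.1.2)%R else f z].

Lemma updates_source (L : seq (K * I * I)) f x :
  (forall t, t \in L -> t.2 != x) -> foldl update f L x = f x.
Proof.
elim: L f => [//|t L IH] f H /=; rewrite IH; last first.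
  by move=> u uL; apply: H; rewrite inE uL orbT.
by rewrite ffunE eq_sym (negbTE (H t _)) // mem_head.
Qed.

(** If no entry is read after it was written, the order of the updates does
    not matter. *)
Lemma updates_pairing (L : seq (K * I * I)) f (g : I -> K) :
  (forall t u, t \in L -> u \in L -> t.2 != u.1.2) ->
  (\sum_x foldl update f L x * g x =
   \sum_x f x * g x + \sum_(t <- L) t.1.1 * f t.1.2 * g t.2)%R.
Proof.
elim/last_ind: L => [|L t IH] H; first by rewrite big_nil addr0.
rewrite foldl_rcons -cats1 big_cat big_seq1 /= addrA -IH; last first.
  by move=> u v uL vL; apply: H; rewrite mem_rcons inE ?uL ?vL orbT.
rewrite (bigD1 t.2) //= [in RHS](bigD1 t.2) //= ffunE eqxx.
rewrite (@updates_source L f t.1.2) => [|u uL]; last first.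
  by apply: H; rewrite mem_rcons inE ?eqxx // uL orbT.
rewrite mulrDl addrAC; congr (_ + _ + _)%R.
by apply: eq_bigr => z /negbTE zt; rewrite ffunE zt.
Qed.

Lemma update_inj (t : K * I * I) : t.2 != t.1.2 -> injective (update^~ t).
Proof.
move=> ne f g /ffunP e; apply/ffunP => z.
have es : f t.1.2 = g t.1.2 by have := e t.1.2; rewrite !ffunE eq_sym (negbTE ne).
by have := e z; rewrite !ffunE; case: eqP => // _; rewrite es => /addIr.
Qed.

Lemma update_surj (t : K * I * I) g : t.2 != t.1.2 -> exists f, update f t = g.
Proof.
move=> ne; exists (update g ((- t.1.1)%R, t.1.2, t.2)); apply/ffunP => z.
rewrite !ffunE /= [t.1.2 == _]eq_sym (negbTE ne); case: eqP => // _.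
by rewrite mulNr subrK.
Qed.

Lemma updates_inj (L : seq (K * I * I)) :
  (forall t, t \in L -> t.2 != t.1.2) -> injective (foldl update^~ L).
Proof.
elim: L => [|t L IH] H f g //= e.
apply: (update_inj (H t (mem_head _ _))); apply: IH e => u uL.
by apply: H; rewrite inE uL orbT.
Qed.

Lemma updates_surj (L : seq (K * I * I)) g :
  (forall t, t \in L -> t.2 != t.1.2) -> exists f, foldl update f L = g.
Proof.
elim: L => [|t L IH] H /=; first by exists g.
have [|f ef] := IH; first by move=> u uL; apply: H; rewrite inE uL orbT.
have [f' ef'] := @update_surj t f (H t (mem_head _ _)).
by exists f'; rewrite ef' ef.
Qed.

End Updates.

Lemma path_mid_le n h m : is_path (n + n) 0 h -> m <= n + n -> h m <= n.
Proof.
move=> hp mN; have [h1 h2] := unglue hp.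
case: (leqP m n) => mn; first by apply: leq_trans (is_path_le h1 mn) mn.
have := is_path_le h2 (_ : n + n - m <= n); have -> : n + n - (n + n - m) = m by lia.
by move=> H; apply: leq_trans (H _) _; lia.
Qed.

Section Enclosing.
Variables (N : nat) (f : nat -> nat).
Hypothesis nf : ncmatch N f.

(** The innermost arc around the arc that opens at [a] closes at [z]. *)
Definition encloses (a z : nat) : bool :=
  [&& z < N, f a < z, f z < a & [forall w : 'I_N, (f a < w < z) ==> (a <= f w)]].

Lemma encloses_lt a z : encloses a z -> [/\ z < N, f z < a, f a < z &
   forall w, f a < w -> w < z -> a <= f w].
Proof.
move=> /and4P[zN fz za /forallP H]; split=> // w w1 w2.
by have := H (Ordinal (ltn_trans w2 zN)); rewrite /= w1 w2.
Qed.

Lemma encloses_none a : a < f a -> a < N -> (forall z, ~~ encloses a z) ->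
  forall z, z < N -> f a < z -> a <= f z.
Proof.
move=> af aN none z; have [s] := ubnP z; elim: s z => // s IH z zs zN az.
rewrite leqNgt; apply: contra (none z) => fz; apply/and4P; split => //.
apply/forallP => w; apply/implyP => /andP[w1 w2].
by apply: IH => //; lia.
Qed.

Lemma encloses_visible a z : a < f a -> a < N -> encloses a z ->
  forall w, w < N -> w != f z -> w != a -> w != z -> w != f a ->
   side w (f w) (f z) = side w (f w) a.
Proof.
move=> af aN /encloses_lt[zN fz az H] w wN w1 w2 w3 w4.
have [fN ff fx nc] := nf.
have n1 : f w != z by apply: (ncmatch_mate_neq nf).
have n2 : f w != f z by apply: (ncmatch_mate_neq nf) => //; rewrite ?fN ?ff.
have n3 : f w != a by apply: (ncmatch_mate_neq nf).
have n4 : f w != f a by apply: (ncmatch_mate_neq nf) => //; rewrite ?fN ?ff.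
have := H w; have := H (f w); rewrite ff //.
have := nc a w aN wN w2 w4; have := nc z w zN wN w3 w1.
have := fN w wN; rewrite /side; lia.
Qed.

(** Between the opener of an innermost enclosing arc and [a], arcs close among
    themselves. *)
Lemma level_enclosed a z g : a < f a -> a < N -> encloses a z ->
  consistent N f g -> g (f z).+1 = g a.
Proof.
move=> af aN en cg; have [zN fz az H] := encloses_lt en; have vis := encloses_visible af aN en.
have [fN ff fx nc] := nf.
apply: (region nf) => // [|w wi]; first exact: ltnW.
have wN : w < N by lia.
rewrite cg // eqxx andbT.
have w1 : w != f z by lia.
have w2 : w != a by lia.
have w3 : w != z by lia.
have w4 : w != f a by lia.
have n1 : f w != z by apply: (ncmatch_mate_neq nf).
have n2 : f w != f z by apply: (ncmatch_mate_neq nf) => //; rewrite ?fN ?ff.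
have n3 : f w != a by apply: (ncmatch_mate_neq nf).
have := vis w wN w1 w2 w3 w4; have := nc z w zN wN w3 w1; rewrite /side; lia.
Qed.

Lemma level_outer a g : a < f a -> a < N -> (forall z, ~~ encloses a z) ->
  consistent N f g -> g 0 = g a.
Proof.
move=> af aN none cg; have H := encloses_none af aN none.
have [fN ff fx nc] := nf.
apply: (region nf) => // [|w wi]; first exact: ltnW.
have wN : w < N by lia.
rewrite cg // eqxx andbT.
have w2 : w != a by lia.
have w4 : w != f a by lia.
have n3 : f w != a by apply: (ncmatch_mate_neq nf).
have n4 : f w != f a by apply: (ncmatch_mate_neq nf) => //; rewrite ?fN ?ff.
have := nc a w aN wN w2 w4.
have := H (f w) (fN w wN); rewrite ff // /side; lia.
Qed.

End Enclosing.

Section Algorithm.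
Variables (K : fieldType) (q : K).
Hypothesis q_gen : forall a, qnum q a.+1 != 0%R.
Variable n : nat.
Implicit Types (d : diagram n) (h : nat -> nat).
Local Notation N := (n + n).
Local Notation hgt d := (height (mate d)).

Definition enclosing d a : option 'I_N := [pick z : 'I_N | encloses N (mate d) a z].

(** Coefficients and diagrams which together represent [c] times the state sum
    of [d] on the paths that fall at [a].  An exchange with the innermost
    enclosing arc replaces falling at [a] by rising at the mate of [a]; that is
    everything except falling there, which accounts for the sign and for the
    recursive call.  The number [e] is the height at [a], that is the number of
    enclosing arcs. *)
Fixpoint chain (e : nat) d (a : nat) (c : K) : seq (K * diagram n) :=
  if e is e'.+1 then
    if enclosing d a is Some z then
      let d' := rewired d (mate d z) a in
      let c' := (c * (qnum q e / qnum q e.+1))%R in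
      (c', d') :: chain e' d' (mate d a) (- c')%R
    else [::]
  else [::].

Lemma size_chain e d a c : size (chain e d a c) <= e.
Proof. by elim: e d a c => //= e IH d a c; case: enclosing => //= z; apply: IH. Qed.

Lemma height_prefix d d' m : m <= N ->
  (forall p, p < m -> (p < mate d p) = (p < mate d' p)) ->
  forall p, p <= m -> hgt d p = hgt d' p.
Proof.
move=> mN e.
have pre d0 : is_path m (hgt d0 m) (hgt d0).
  have [h0 hN st] := height_path (mate_ncmatch d0).
  by split=> // p pm; apply: st; lia.
apply: (path_ext (pre d) (pre d')) => p pm.
by rewrite !(height_ltE (mate_ncmatch _)) ?e //; lia.
Qed.

(** Exchanging keeps the invariants of the recursion: all arcs around the
    current one open before [m], the heights up to [m] are those of the
    original diagram, and the level drops by one. *)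
Lemma chain_link d a z m : m <= a -> a < mate d a -> a < N ->
  (forall p, p < a -> mate d a < mate d p -> p < m) ->
  encloses N (mate d) a z ->
  let d' := rewired d (mate d z) a in let b := mate d a in
  [/\ [/\ m <= b, b < mate d' b & b < N],
      (forall p, p < b -> mate d' b < mate d' p -> p < m),
      (forall p, p <= m -> hgt d' p = hgt d p),
      (mate d' a < a) /\ (forall p, p < N -> p != mate d z -> p != a -> p != z -> p != mate d a -> mate d' p = mate d p) &
      (hgt d a = (hgt d' b).+1) /\ (mate d z < m)].
Proof.
move=> ma af aN inv en d' b.
have nf := mate_ncmatch d; have [fN ff fx nc] := nf.
have [zN fz az H] := encloses_lt en.
have xm : mate d z < m by apply: inv; rewrite ?ff.
have xN : mate d z < N by apply: fN.
have vis := encloses_visible nf af aN en.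
have nr : ncmatch N (rewire (mate d) (mate d z) a).
  by apply: rewire_ncmatch => //; rewrite ?ff //; rewrite /side; lia.
have md p : p < N -> mate d' p = rewire (mate d) (mate d z) a p by apply: of_funK.
have dx : mate d' (mate d z) = a by rewrite md // /rewire eqxx.
have da : mate d' a = mate d z by rewrite md // /rewire eqxx gtn_eqF.
have db : mate d' b = z.
  rewrite md ?fN // /rewire ff //.
  have [b1 b2 b3] : [/\ b != mate d z, b != a & b != z] by split; rewrite /b; lia.
  by rewrite (negbTE b1) (negbTE b2) (negbTE b3) eqxx.
have dz : mate d' z = b.
  have [z1 z2] : z != mate d z /\ z != a by lia.
  by rewrite md // /rewire ff // (negbTE z1) (negbTE z2) eqxx.
have doth p : p < N -> p != mate d z -> p != a -> p != z -> p != mate d a -> mate d' p = mate d p.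
  by move=> pN *; rewrite md // /rewire ff // !ifN.
have hp : forall p, p <= m -> hgt d' p = hgt d p.
  apply: height_prefix => [|p pm]; first by lia.
  case: (eqVneq p (mate d z)) => [->|px]; first by rewrite dx ff //; lia.
  by rewrite doth //; lia.
split=> //; rewrite ?db //.
- split; [by rewrite /b; lia|by []|exact: fN].
- move=> p pb zp.
  have pN : p < N by have := fN a aN; rewrite -/b; lia.
  have px : p != mate d z by apply: contraTneq zp => ->; rewrite dx; lia.
  have pa : p != a by apply: contraTneq zp => ->; rewrite da; lia.
  have pz : p != z by lia.
  have pb' : p != mate d a by rewrite -/b; lia.
  rewrite doth // in zp.
  apply: inv; last by rewrite -/b; lia.
  by have := nc a p aN pN pa pb'; rewrite -/b /side; lia.
- by rewrite da.
split=> //.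
have e1 := level_enclosed nf af aN en (height_consistent nf).
have e2 := height_consistent (mate_ncmatch d') aN; rewrite da in e2.
have e3 : hgt d' a.+1 = hgt d' b.
  have nd' := mate_ncmatch d'; have bN := fN a aN.
  apply: (region nd') => // [|w wi]; first exact: ltnW.
  have wN : w < N by rewrite /b in wi; lia.
  rewrite (height_consistent nd') // eqxx andbT doth //; try (rewrite /b in wi; lia).
  have w1 : w != a by lia.
  have w2 : w != mate d a by rewrite /b in wi; lia.
  have n1 : mate d w != a by apply: (ncmatch_mate_neq nf).
  have n2 : mate d w != mate d a by apply: (ncmatch_mate_neq nf) => //; rewrite ff.
  by have := nc a w aN wN w1 w2; rewrite /b in wi *; rewrite /side; lia.
rewrite -e3 -e2 hp ?(ltnW xm) // -e1 (height_up nf) ?ff //; lia.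
Qed.

(** At level 0 a path cannot fall.  Above, the enclosing arc opens before [m],
    where the path follows the diagram and hence rises, as
    [statesum_exchange] demands. *)
Lemma chain_correct e d a m h c : is_path N 0 h ->
  (forall p, p <= m -> h p = hgt d p) ->
  m <= a -> a < mate d a -> a < N ->
  (forall p, p < a -> mate d a < mate d p -> p < m) -> hgt d a = e ->
  (c * (statesum q N (mate d) h *+ (h a.+1 < h a)%N) =
   \sum_(t <- chain e d a c) t.1 * statesum q N (mate t.2) h)%R.
Proof.
move=> hp; have [h0 hN st] := hp.
elim: e d a c => [|e IH] d a c ag ma af aN inv da.
all: have nf := mate_ncmatch d; have [fN ff fx nc] := nf.
all: rewrite /= ?big_nil; case E : (enclosing d a) => [z|].
1,3: move: E; rewrite /enclosing; case: pickP => // y en [?]; subst y.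
3,4: move: E; rewrite /enclosing; case: pickP => // none _.
3,4: have {}none y : ~~ encloses N (mate d) a y by
  [case: (ltnP y N) => yN; [have := none (Ordinal yN) => /= -> | apply/negP => /encloses_lt[]; lia]].
- have [_ _ _ _ [hh _]] := chain_link ma af aN inv en.
  by rewrite hh in da.
- have [[mb bd bN] inv' ag' _ [hh xm]] := chain_link ma af aN inv en.
  have [zN fz az H] := encloses_lt en.
  have vis := encloses_visible nf af aN en.
  set d' := rewired d (mate d z) a in mb bd bN inv' ag' hh *.
  set b := mate d a in mb bd bN inv' hh *.
  have xN : mate d z < N by apply: fN.
  have nr : ncmatch N (rewire (mate d) (mate d z) a).
    by apply: rewire_ncmatch => //; rewrite ?ff //; rewrite /side; lia.
  have md p : p < N -> mate d' p = rewire (mate d) (mate d z) a p by apply: of_funK.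
  have SE : statesum q N (mate d') h = statesum q N (rewire (mate d) (mate d z) a) h.
    by apply: eq_big => x; rewrite ?md.
  have hx : h (mate d z).+1 = (h (mate d z)).+1.
    by rewrite !ag ?(ltnW xm) // (height_up nf) ?ff //; lia.
  rewrite big_cons /= -IH //; try by [move=> p pm; rewrite ag' // ag|lia].
  rewrite (@statesum_exchange _ _ _ _ h (mate d z) a) ?ff // -SE -/b.
  set X := statesum _ _ (mate d') h.
  have -> : (c * (qnum q e.+1 / qnum q e.+2) * X +
     - (c * (qnum q e.+1 / qnum q e.+2)) * (X *+ (h b.+1 < h b)%N) =
     (c * (qnum q e.+1 / qnum q e.+2)) * (X *+ (h b < h b.+1)%N))%R.
    by have [->|->] := st b bN; rewrite ltnSn ltnNge leqnSn /= ?mulr0n ?mulr1n; ring.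
  have [->|Xnz] := eqVneq X 0%R; first by rewrite mul0rn !mulr0.
  have -> : h a = e.+1; last by rewrite mulrA.
  have := statesum_neq0 (mate_ncmatch d') Xnz xN.
  rewrite md // {1}/rewire eqxx => ->.
  by rewrite ag // (level_enclosed nf af aN en (height_consistent nf)).
- have [->|nz] := eqVneq (statesum q N (mate d) h) 0%R; first by rewrite mul0rn mulr0.
  have <- := level_outer nf af aN none (statesum_neq0 nf nz).
  by rewrite h0 ltn0 mulr0n mulr0.
- by have := level_outer nf af aN none (height_consistent nf); rewrite da height0.
Qed.

(** Stage [m] reads diagrams with an opener at [m] and writes to diagrams with a
    closer there, so its updates do not interfere. *)
Lemma chain_targets e d a m c : m <= a -> a < mate d a -> a < N ->
  (forall p, p < a -> mate d a < mate d p -> p < m) ->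
  (m = a \/ mate d m < m) ->
  forall t, t \in chain e d a c -> mate t.2 m < m /\ (forall p, p <= m -> hgt t.2 p = hgt d p).
Proof.
elim: e d a c => [//|e IH] d a c ma af aN inv ma' t /=.
case E : (enclosing d a) => [z|//].
move: E; rewrite /enclosing; case: pickP => // y en [?]; subst y.
have [[mb bd bN] inv' ag' [da oth] [hh xm]] := chain_link ma af aN inv en.
have [zN fz az H] := encloses_lt en.
set d' := rewired d (mate d z) a in mb bd bN inv' ag' da oth hh *.
have md'm : mate d' m < m.
  case: ma' => [->//|lt]; case: (eqVneq m a) => [->//|mna].
  by rewrite oth //; lia.
rewrite inE => /orP[/eqP->//|tc].
have [] := IH _ _ _ mb bd bN inv' (or_intror md'm) t tc.
by move=> ? H'; split=> // p pm; rewrite H' // ag'.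
Qed.

Definition stage (m : nat) : seq (K * diagram n * diagram n) :=
  flatten [seq [seq (t.1, d, t.2) | t <- chain (hgt d m) d m 1%R] |
            d <- enum (diagram n) & m < mate d m].

Lemma stageP m t : m < N -> t \in stage m ->
  m < mate t.1.2 m /\ mate t.2 m < m.
Proof.
move=> mN /flatten_mapP[d]; rewrite mem_filter => /andP[md _] /mapP[u uc ->] /=.
by split=> //; have [] := chain_targets (leqnn m) md mN (fun p pm _ => pm) (or_introl erefl) uc.
Qed.

(** The state sum on the paths which follow the heights of [d] up to [m].  It is
    the full state sum for [m = 0], and isolates the path of [d] itself when
    [m] is the number of points. *)
Definition truncated (m : nat) d h : K :=
  if [forall p : 'I_m.+1, h p == hgt d p] then statesum q N (mate d) h else 0%R.

Lemma truncatedE m d h : (forall p, p <= m -> h p = hgt d p) ->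
  truncated m d h = statesum q N (mate d) h.
Proof.
move=> e; rewrite /truncated; case: forallP => // -[] p.
by rewrite e // -ltnS.
Qed.

Lemma truncated_neq0 m d h : truncated m d h != 0%R -> forall p, p <= m -> h p = hgt d p.
Proof.
rewrite /truncated; case: forallP => [H _ p pm|]; last by rewrite eqxx.
by apply/eqP; apply: (H (Ordinal (pm : p < m.+1))).
Qed.

(** Where an arc closes, consistency forces the height. *)
Lemma truncated_closer m d h : m < N -> mate d m < m ->
  truncated m.+1 d h = truncated m d h.
Proof.
move=> mN dm; have nf := mate_ncmatch d; have [fN ff fx nc] := nf.
have [e0|nz] := eqVneq (truncated m d h) 0%R.
  rewrite e0; apply/eqP; apply: contraTT isT => nz; move: (nz).
  rewrite truncatedE; last exact: truncated_neq0 nz.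
  by rewrite -(@truncatedE m) ?e0 ?eqxx // => p pm; apply: (truncated_neq0 nz); lia.
have ag := truncated_neq0 nz; rewrite truncatedE // in nz *.
rewrite truncatedE // => p; rewrite leq_eqVlt => /orP[/eqP->|]; last exact: ag.
have c1 := statesum_neq0 nf nz mN; have c2 := height_consistent nf mN.
by rewrite -c1 -c2 ag // ltnW.
Qed.

Lemma truncated_opener m d h : m < N -> m < mate d m -> is_path N 0 h ->
  (truncated m d h = truncated m.+1 d h +
    \sum_(t <- chain (hgt d m) d m 1%R) t.1 * truncated m.+1 t.2 h)%R.
Proof.
move=> mN dm hp; have nf := mate_ncmatch d; have [fN ff fx nc] := nf.
have inv p : p < m -> mate d m < mate d p -> p < m by move=> pm _.
have tg := @chain_targets (hgt d m) d m m 1%R (leqnn m) dm mN (fun p pm _ => pm) (or_introl erefl).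
case: (boolP [forall p : 'I_m.+1, h p == hgt d p]) => [/forallP ag|nag]; last first.
  have z m' d0 : m <= m' -> (forall p, p <= m -> hgt d0 p = hgt d p) ->
      truncated m' d0 h = 0%R.
    move=> mm' e; rewrite /truncated; case: forallP => // ag.
    case/negP: nag; apply/forallP => p; have pm : p <= m by rewrite -ltnS.
    by have := ag (Ordinal (leq_trans pm mm' : p < m'.+1)); rewrite /= e.
  rewrite !z // add0r big_seq big1 // => t /tg[_ e].
  by rewrite z ?mulr0.
have {}ag p : p <= m -> h p = hgt d p.
  by move=> pm; apply/eqP; apply: (ag (Ordinal (pm : p < m.+1))).
rewrite truncatedE //.
have -> : (\sum_(t <- chain (hgt d m) d m 1%R) t.1 * truncated m.+1 t.2 h =
  \sum_(t <- chain (hgt d m) d m 1%R) t.1 * statesum q N (mate t.2) h)%R.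
  rewrite big_seq [RHS]big_seq; apply: eq_bigr => t /tg[lt e].
  by rewrite truncated_closer // truncatedE // => p pm; rewrite e // ag.
rewrite -(chain_correct 1%R hp ag (leqnn m) dm mN inv erefl) mul1r.
have [_ _ st] := hp; have up := height_up nf mN dm.
have [e|e] := st m mN.
  rewrite e ltnNge leqnSn mulr0n addr0 truncatedE // => p.
  by rewrite leq_eqVlt => /orP[/eqP->|]; [rewrite e up ag|exact: ag].
rewrite e ltnSn mulr1n [truncated _ _ _](_ : _ = 0%R) ?add0r //.
apply/eqP; apply: contraTT isT => /truncated_neq0 H.
by have := H m.+1 (leqnn _); rewrite up -ag //; lia.
Qed.

Definition stages : seq (K * diagram n * diagram n) :=
  flatten [seq stage m | m <- iota 0 N].

Lemma stage_correct m (f : {ffun diagram n -> K}) h : m < N -> is_path N 0 h ->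
  (\sum_d f d * truncated m d h =
   \sum_d foldl (@update K _) f (stage m) d * truncated m.+1 d h)%R.
Proof.
move=> mN hp; rewrite updates_pairing; last first.
  move=> t u /(stageP mN)[_ t2] /(stageP mN)[u1 _].
  by apply: contraTneq u1 => <-; rewrite -leqNgt ltnW.
rewrite /stage big_flatten /= big_map big_filter big_enum_cond /=.
rewrite [X in (_ + X)%R]big_mkcond /= -big_split /=; apply: eq_bigr => d _.
case: ifP => dm.
  rewrite big_map truncated_opener // mulrDr mulr_sumr; congr (_ + _)%R.
  by apply: eq_bigr => t _ /=; ring.
rewrite addr0 truncated_closer //.
by have [_ _ fx _] := mate_ncmatch d; have := fx m mN; lia.
Qed.

Lemma stages_correct (f : {ffun diagram n -> K}) d :
  (foldl (@update K _) f stages d = \sum_c f c * statesum q N (mate c) (hgt d))%R.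
Proof.
have nf := mate_ncmatch d; have hp := height_path nf.
have H m : m <= N -> (\sum_c f c * truncated 0 c (hgt d) =
   \sum_c foldl (@update K _) f (flatten [seq stage m | m <- iota 0 m]) c * truncated m c (hgt d))%R.
  elim: m => [//|m IH] mN; rewrite IH ?(ltnW mN) // stage_correct //.
  by rewrite -addn1 iotaD map_cat flatten_cat foldl_cat /= cats0 addn1.
have -> : (\sum_c f c * statesum q N (mate c) (hgt d) =
           \sum_c f c * truncated 0 c (hgt d))%R.
  apply: eq_bigr => c _; rewrite truncatedE // => p.
  by rewrite leqn0 => /eqP ->; rewrite !height0.
rewrite (H N (leqnn N)) -/stages (bigD1 d) //= truncatedE // statesum_height // mulr1.
rewrite big1 ?addr0 // => c cd.
have [->|/truncated_neq0 e] := eqVneq (truncated N c (hgt d)) 0%R; first by rewrite mulr0.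
case/eqP: cd; apply: mate_inj; apply: ncmatch_ext (mate_ncmatch c) nf _ => x xN.
by rewrite -!(height_ltE (mate_ncmatch _)) // !e // ltnW.
Qed.

Lemma stages_distinct t : t \in stages -> t.2 != t.1.2.
Proof.
case/flatten_mapP => m; rewrite mem_iota => /andP[_ mN] /(stageP mN)[h1 h2].
by apply: contraTneq h1 => <-; rewrite -leqNgt ltnW.
Qed.

Lemma size_stages : size stages <= N * (n.-1 * #|diagram n|).
Proof.
rewrite /stages size_flatten /shape -map_comp sumnE big_map.
have -> : N * (n.-1 * #|diagram n|) = \sum_(m <- iota 0 N) (n.-1 * #|diagram n|).
  by rewrite big_const_seq count_predT size_iota iter_addn_0 mulnC.
rewrite big_seq [leqRHS]big_seq; apply: leq_sum => m; rewrite mem_iota => /andP[_ mN] /=.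
rewrite /stage size_flatten /shape -map_comp sumnE big_map big_filter.
rewrite -sum1_card big_distrr /= big_enum_cond /= /=.
rewrite [X in X <= _]big_mkcond /=; apply: leq_sum => d _; rewrite muln1; case: ifP => // dm.
rewrite size_map; apply: leq_trans (size_chain _ _ _ _) _.
have nf := mate_ncmatch d.
have := path_mid_le (height_path nf) (mN : m.+1 <= n + n).
by rewrite (height_up nf) //; lia.
Qed.

End Algorithm.

(** * Straight-line programs for lists of updates *)

Section Programs.
Variables (K : fieldType) (I : finType).

Lemma opval_rcons (f : I -> K) s v (o : operand K I) w :
  opval f s o = Some w -> opval f (rcons s v) o = Some w.
Proof.
case: o => //= k; elim: s k => [|x s IH] [|k] //=; exact: IH.
Qed.

Lemma opval_last (f : I -> K) s v : opval f (rcons s v) (Reg K I (size s)) = Some v.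
Proof. by rewrite /=; elim: s. Qed.

(** The function [reg] tells where the current value of each entry is found; an
    update multiplies and adds into new registers and redirects one entry. *)
Lemma slp_updates (L : seq (K * I * I)) :
  exists p : slp K I, exists reg : I -> operand K I,
  [/\ additions p = size L, multiplications p = size L &
   forall f : {ffun I -> K}, exists s, [/\ run p f = Some s, size s = size p &
     forall i, opval f s (reg i) = Some (foldl (@update K I) f L i)]].
Proof.
elim/last_ind: L => [|L [[c x] y] [p [reg [pa pm H]]]].
  by exists [::], (@Input K I); split=> // f; exists [::].
exists (p ++ [:: Instr Mul (Const I c) (reg x); Instr Add (reg y) (Reg K I (size p))]).
exists (fun i => if i == y then Reg K I (size p).+1 else reg i).
split.
- by rewrite /additions count_cat -/(additions p) pa size_rcons /= addn1.
- by rewrite /multiplications count_cat -/(multiplications p) pm size_rcons /= addn1.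
move=> f; have [s [rs ss os]] := H f.
set g := foldl _ f L in os.
exists (rcons (rcons s (c * g x)%R) (g y + c * g x)%R); split.
- rewrite /run foldl_cat -/(run p f) rs /= /step /= os /=.
  have := opval_rcons (c * g x)%R (os y) => -> /=.
  by have := opval_last f s (c * g x)%R; rewrite ss /= => ->.
- by rewrite !size_rcons size_cat /= ss addn2.
move=> i; rewrite foldl_rcons -/g ffunE /=.
case: eqP => [->|_]; last by do 2!apply: opval_rcons.
by have := opval_last f (rcons s (c * g x)%R) (g y + c * g x)%R; rewrite size_rcons ss.
Qed.

(** Multiplication of each entry by a constant, written as
    [f x + (w x - 1) * f x] to be a list of updates. *)
Definition rescale (w : I -> K) : seq (K * I * I) :=
  [seq ((w x - 1)%R, x, x) | x <- enum I].

Lemma rescaleE (w : I -> K) (f : {ffun I -> K}) x :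
  (foldl (@update K I) f (rescale w) x = f x * w x)%R.
Proof.
have H (s : seq I) : uniq s -> (foldl (@update K I) f [seq ((w x - 1)%R, x, x) | x <- s] x =
   f x * (if x \in s then w x else 1))%R.
  elim: s f => [|y s IH] f' /=; first by rewrite mulr1.
  move=> /andP[ys us]; rewrite IH // ffunE /= inE; case: (eqVneq x y) => [->|_] //=.
  by rewrite (negbTE ys); ring.
by rewrite H ?enum_uniq // mem_enum.
Qed.

Lemma size_rescale w : size (rescale w) = #|I|.
Proof. by rewrite size_map -cardE. Qed.

End Programs.

(** * The irreducible representations *)

Section Rep.
Local Open Scope ring_scope.
Variable R : realType.
Local Notation K := (Cq R).
Local Notation q := (q R).

(** The quantum integers as polynomials in [q]; their degrees show that none
    but the first vanishes. *)
Fixpoint qpoly (a : nat) : {poly R[i]} :=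
  match a with
  | 0 => 0
  | 1 => 1
  | (b.+1 as c).+1 => 'X * qpoly c - qpoly b
  end.

Lemma qpoly_frac a : qnum q a = tofrac (qpoly a) /\ qnum q a.+1 = tofrac (qpoly a.+1).
Proof.
elim: a => [|a [IH1 IH2]].
  by split; [rewrite tofrac0|rewrite tofrac1].
split; first exact: IH2.
have -> : qnum q a.+2 = q * qnum q a.+1 - qnum q a by rewrite qnumS addrK.
by rewrite IH1 IH2 -rmorphM -rmorphB.
Qed.

Lemma size_qpoly a : size (qpoly a) = a /\ size (qpoly a.+1) = a.+1.
Proof.
elim: a => [|a [IH1 IH2]]; first by split; [rewrite size_poly0|rewrite size_poly1].
split=> //; rewrite -[qpoly a.+2]/('X * qpoly a.+1 - qpoly a).
have nz : qpoly a.+1 != 0 by rewrite -size_poly_gt0 IH2.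
have sX : size ('X * qpoly a.+1) = a.+2 by rewrite mulrC size_mulX // IH2.
by rewrite size_polyDl // sX size_polyN IH1.
Qed.

Lemma q_generic a : qnum q a.+1 != 0.
Proof.
have [-> _] := qpoly_frac a.+1; rewrite tofrac_eq0 -size_poly_gt0.
by have [_ ->] := size_qpoly a.
Qed.

Variable n : nat.
Local Notation D := (diagram n).
Local Notation N := (n + n)%N.

Lemma id_diagram_exists : exists d : D, is_id_diagram d.
Proof.
have [d dE] := ncmatch_diagram (id_ncmatch n); exists d.
apply/forallP => i; apply/eqP/pos_inj; rewrite -mate_pos dE ?pos_lt //.
Qed.

Lemma id_diagram_unique (d e : D) : is_id_diagram d -> is_id_diagram e -> d = e.
Proof. by move=> hd he; apply: mate_inj => x xN; rewrite !mate_is_id. Qed.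

Lemma diagram_mul (d e : D) : exists f,
  (forall c, concatenation d e c = (c == f)) /\
  (forall k P Q, is_path n k P -> is_path n k Q ->
    \sum_(X : hpath n k) entry q d P (hfun X) * entry q e (hfun X) Q =
     q ^+ loops d e * entry q f P Q).
Proof.
have [f [l [Hc Hp]]] := diagram_product q_generic d e; exists f.
rewrite (colourings_loops Hc); split=> // c.
by apply/idP/eqP => [|->]; [exact: colourings_unique Hc|exact: colourings_concatenation Hc].
Qed.

Definition rep_dim (k : nat) : nat := #|hpath n k|.

Definition rep_mx (k : nat) (f : TL R n) : 'M[K]_(rep_dim k) :=
  \matrix_(i, j) \sum_(d : D) (f d : K) * entry q d (hfun (enum_val i)) (hfun (enum_val j)).

Lemma rep_mx_linear k : linear (@rep_mx k).
Proof.
move=> a f g; apply/matrixP => i j; rewrite !mxE mulr_sumr -big_split /=.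
apply: eq_bigr => d _.
have -> : ((a *: f + g) d : K) = a * (f d : K) + (g d : K) by rewrite !ffunE.
by rewrite mulrDl -mulrA.
Qed.

HB.instance Definition _ k :=
  GRing.isLinear.Build K (TL R n) 'M[K]_(rep_dim k) _ (@rep_mx k) (@rep_mx_linear k).

Lemma rep_mx1 k : rep_mx k (TLone R n) = 1%:M.
Proof.
have [e ide] := id_diagram_exists; apply/matrixP => i j; rewrite !mxE.
rewrite (bigD1 e) //= big1 ?addr0 => [|d de]; last first.
  rewrite ffunE; case: (boolP (is_id_diagram d)) => [idd|_]; last by rewrite mul0r.
  by case/eqP: de; apply: id_diagram_unique.
rewrite ffunE ide mul1r (entry_id q_generic ide (hfun_path _) (hfun_path _)).
congr ((nat_of_bool _)%:R); apply/forallP/eqP => [H|-> //].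
apply: enum_val_inj; apply: hfun_inj => m mn.
by apply/eqP; apply: (H (Ordinal (mn : (m < n.+1)%N))).
Qed.

Lemma rep_mxM k (f g : TL R n) : rep_mx k (TLmul f g) = rep_mx k f *m rep_mx k g.
Proof.
apply/matrixP => i j; rewrite !mxE.
set P := hfun (enum_val i); set Q := hfun (enum_val j).
have hP : is_path n k P := hfun_path _; have hQ : is_path n k Q := hfun_path _.
transitivity (\sum_(a : D) \sum_(b : D) (f a : K) * (g b : K) *
   \sum_(X : hpath n k) entry q a P (hfun X) * entry q b (hfun X) Q).
  under eq_bigr => c _ do rewrite ffunE mulr_suml.
  rewrite exchange_big /=; apply: eq_bigr => a _.
  under eq_bigr => c _ do rewrite big_mkcond mulr_suml.
  rewrite exchange_big /=; apply: eq_bigr => b _.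
  have [c0 [cE pE]] := diagram_mul a b.
  rewrite (bigD1 c0) //= big1 => [|c cc0]; last by rewrite cE (negbTE cc0) mul0r.
  by rewrite cE eqxx addr0 pE // [RHS]mulrA.
transitivity (\sum_(X : hpath n k) (\sum_(a : D) (f a : K) * entry q a P (hfun X)) *
   (\sum_(b : D) (g b : K) * entry q b (hfun X) Q)).
  under eq_bigr => a _ do under eq_bigr => b _ do rewrite mulr_sumr.
  under eq_bigr => a _ do rewrite exchange_big.
  rewrite exchange_big /=; apply: eq_bigr => X _; rewrite mulr_suml.
  apply: eq_bigr => a _; rewrite mulr_sumr; apply: eq_bigr => b _.
  by rewrite mulrACA.
rewrite (reindex (@enum_val _ (hpath n k))) /=; last first.
  by apply: onW_bij; apply: enum_val_bij.
by apply: eq_bigr => x _; rewrite !mxE.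
Qed.

Definition rep (k : nat) : mxrep R n :=
  @MxRep R n (rep_dim k) (@rep_mx k) (rep_mx1 k) (@rep_mxM k).

Definition fft (f : TL R n) : {ffun D -> K} := foldl (@update K D) f (stages q n).

(** The scale of the column in which the path of [d] ends up. *)
Definition end_scale (d : D) : K := scale q n (fun m => height (mate d) (N - m)).

(** The entry with indices [i] and [j] is found at the diagram whose heights run
    along the path of [i] and back along the path of [j]. *)
Lemma rep_mx_fft k (i j : 'I_(rep_dim k)) : exists d : D,
  (forall m, (m <= N)%N -> height (mate d) m =
       glue n (hfun (enum_val i)) (hfun (enum_val j)) m) /\
  (end_scale d != 0 /\ forall f, rep_mx k f i j = fft f d / end_scale d).
Proof.
set P := hfun (enum_val i); set Q := hfun (enum_val j).
have hP : is_path n k P := hfun_path _; have hQ : is_path n k Q := hfun_path _.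
have hp := glue_path hP hQ.
have [g ng gE] := path_matching hp; have [d dE] := ncmatch_diagram ng.
exists d; have nd := mate_ncmatch d.
have hE m : (m <= N)%N -> height (mate d) m = glue n P Q m.
  apply: (path_ext (height_path nd) hp) => x xN.
  by rewrite (height_ltE nd) // dE // gE.
have sE : end_scale d = scale q n Q.
  apply: eq_bigr => x _; have xn := ltn_ord x.
  by rewrite !hE ?leq_subr // !(glue_right hP hQ) // ltnW.
split=> //; rewrite sE (scale_neq0 q_generic hQ); split=> // f.
rewrite mxE /fft stages_correct mulr_suml; apply: eq_bigr => c _.
rewrite -mulrA; congr (_ * (_ / _)).
by apply: statesum_ext (mate_ncmatch c) _ => m mN; rewrite hE.
Qed.

Lemma height_diagram (d e : D) : (forall m, (m <= N)%N -> height (mate d) m = height (mate e) m) ->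
  d = e.
Proof.
move=> H; apply: mate_inj; apply: (ncmatch_ext (mate_ncmatch d) (mate_ncmatch e)) => x xN.
by rewrite -!(height_ltE (mate_ncmatch _)) // !H // ltnW.
Qed.

(** Every output of the transform occurs as a matrix entry, and its updates are
    injective. *)
Lemma rep_mx_inj (f g : TL R n) : (forall k, rep_mx k f = rep_mx k g) -> f = g.
Proof.
move=> e; suff : fft f = fft g by apply: updates_inj; exact: stages_distinct.
apply/ffunP => d; have [h1 h2] := unglue (height_path (mate_ncmatch d)).
have [P PE] := hpath_of h1; have [Q QE] := hpath_of h2.
have := e (height (mate d) n) => /matrixP /(_ (enum_rank P) (enum_rank Q)).
have [c [cE [sc fE]]] := rep_mx_fft (enum_rank P) (enum_rank Q).
have cd : c = d.
  apply: height_diagram => m mN; rewrite cE // !enum_rankK.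
  rewrite -[RHS](@glue_unglue n) // /glue; case: leqP => mn; first exact: PE.
  by rewrite QE //; lia.
rewrite !fE; subst c; exact: (mulIf (invr_neq0 sc)).
Qed.

(** The updates of the transform are surjective, so its outputs can be
    prescribed. *)
Lemma rep_unit k (i j : 'I_(rep_dim k)) : exists f : TL R n,
  rep_mx k f = delta_mx i j /\ forall l, l != k -> rep_mx l f = 0.
Proof.
have [c [cE [sc _]]] := rep_mx_fft i j.
have [f fE] := updates_surj [ffun d => (d == c)%:R * end_scale c] (@stages_distinct _ q n).
have gE d : fft f d = (d == c)%:R * end_scale c by rewrite /fft fE ffunE.
have coef l (i' j' : 'I_(rep_dim l)) : exists c', 
  (forall m, (m <= N)%N -> height (mate c') m =
       glue n (hfun (enum_val i')) (hfun (enum_val j')) m) /\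
  rep_mx l f i' j' = (c' == c)%:R.
  have [c' [cE' [sc' fE']]] := rep_mx_fft i' j'; exists c'; split=> //.
  by rewrite fE' gE; case: eqP => [->|_]; rewrite ?mul1r ?divff // !mul0r.
have top l (P Q : hpath n l) : glue n (hfun P) (hfun Q) n = l.
  by rewrite /glue leqnn; have [] := hfun_path P.
exists f; split=> [|l lk]; apply/matrixP => i' j'; rewrite [RHS]mxE; last first.
  have [c' [cE' ->]] := coef l i' j'.
  case: eqP => [cc|_]; [case/eqP: lk|exact: mulr0n].
  by rewrite -(top _ (enum_val i') (enum_val j')) -cE' ?leq_addr // cc cE ?leq_addr // top.
have [c' [cE' ->]] := coef k i' j'.
suff -> : (c' == c) = (i' == i) && (j' == j) by [].
apply/eqP/andP => [cc|[/eqP ii /eqP jj]]; last first.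
  by apply: height_diagram => m mN; rewrite cE' // cE // ii jj.
have e m : (m <= N)%N -> glue n (hfun (enum_val i')) (hfun (enum_val j')) m =
    glue n (hfun (enum_val i)) (hfun (enum_val j)) m by move=> mN; rewrite -cE' // cc cE.
split; apply/eqP/enum_val_inj/hfun_inj => m mn.
  by have := e m (leq_trans mn (leq_addr _ _)); rewrite /glue mn.
by have := e (N - m)%N (leq_subr _ _); rewrite !(glue_right (hfun_path _) (hfun_path _)).
Qed.


Definition unit_elt k (i j : 'I_(rep_dim k)) : TL R n := projT1 (cid (rep_unit i j)).

Lemma rep_unit_elt k (i j : 'I_(rep_dim k)) : rep_mx k (unit_elt i j) = delta_mx i j.
Proof. by rewrite /unit_elt; case: cid => f []. Qed.

Lemma rep_unit_elt0 k l (i j : 'I_(rep_dim k)) : l != k -> rep_mx l (unit_elt i j) = 0.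
Proof. by move=> lk; rewrite /unit_elt; case: cid => f [_ H] /=; apply: H. Qed.

(** A column of matrix units spans a left ideal which is a copy of the
    representation. *)
Lemma mul_unit_elt k f (i j : 'I_(rep_dim k)) :
  TLmul f (unit_elt i j) = \sum_i' rep_mx k f i' i *: unit_elt i' j.
Proof.
apply: rep_mx_inj => l; rewrite rep_mxM linear_sum /=.
under [RHS]eq_bigr => i' _ do rewrite linearZ /=.
have [->|lk] := eqVneq l k; last first.
  by rewrite rep_unit_elt0 // mulmx0 big1 // => i' _; rewrite rep_unit_elt0 // scaler0.
rewrite rep_unit_elt; under [RHS]eq_bigr => i' _ do rewrite rep_unit_elt.
apply/matrixP => a b; rewrite !mxE summxE (bigD1 i) //= big1 => [|x xi]; last first.
  by rewrite !mxE (negbTE xi) mulr0.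
rewrite (bigD1 a) //= big1 => [|x xa]; last by rewrite !mxE [a == x]eq_sym (negbTE xa) mulr0.
by rewrite !mxE !eqxx /= !addr0.
Qed.

Lemma unit_elt_sum :
  TLone R n = \sum_(k < n.+1) \sum_i unit_elt (i : 'I_(rep_dim k)) i.
Proof.
apply: rep_mx_inj => l; rewrite rep_mx1 linear_sum /=.
case: (ltnP l n.+1) => ln; last first.
  apply/matrixP => i; have [_ pn _] := hfun_path (enum_val i).
  by have := is_path_le (hfun_path (enum_val i)) (leqnn n); rewrite pn; lia.
rewrite (bigD1 (Ordinal ln)) //= [X in _ + X]big1 ?addr0 => [|k kl]; last first.
  rewrite linear_sum big1 // => i _; apply: rep_unit_elt0.
  by rewrite eq_sym -(inj_eq val_inj) in kl *.
rewrite linear_sum /=; under eq_bigr => i _ do rewrite rep_unit_elt.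
by apply/matrixP => a b; rewrite mx1_sum_delta.
Qed.

(** Matrix units carry a nonzero coordinate of a vector to any basis vector. *)
Lemma rep_irreducible k : (0 < rep_dim k)%N -> irreducible (rep k).
Proof.
move=> dk; split=> // W inv.
have [->|W0] := eqVneq W 0%VS; [by left|right].
have vW := memv_pick W; have v0 : vpick W != 0 by rewrite vpick0.
set v := vpick W in vW v0.
have [b vb] : exists b, v b 0 != 0.
  apply/existsP; apply: contraNT v0; rewrite negb_exists => /forallP H.
  by apply/eqP/colP => b; rewrite mxE; apply/eqP; rewrite -[_ == _]negbK.
have eW (i : 'I_(rep_dim k)) : delta_mx i 0 \in W.
  have := inv (unit_elt i b) v vW; rewrite /= rep_unit_elt => dW.
  have -> : delta_mx i 0 = (v b 0)^-1 *: (delta_mx i b *m v).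
    apply/matrixP => x y; rewrite ord1 !mxE (bigD1 b) //= big1 => [|z zb].
      by rewrite !mxE !eqxx !andbT addr0 mulrCA mulVf ?mulr1.
    by rewrite !mxE (negbTE zb) andbF mul0r.
  exact: memvZ.
apply/vspaceP => u; rewrite memvf.
rewrite (matrix_sum_delta u); apply: memv_suml => i _; apply: memv_suml => j _.
by rewrite ord1; apply: memvZ.
Qed.

Lemma rep_inequivalent k l : (0 < rep_dim k)%N -> equivalent (rep k) (rep l) -> k = l.
Proof.
move=> dk [P [Q [_ _ H]]]; apply/eqP; rewrite eq_sym; apply: contraT => lk.
pose i := Ordinal dk; have := H (unit_elt i i).
rewrite /= rep_unit_elt rep_unit_elt0 // mulmx0 mul0mx => /matrixP /(_ i i).
by rewrite !mxE !eqxx => /eqP; rewrite oner_eq0.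
Qed.

(** The identity is a sum of matrix units, so one of them acts on [s] as a
    nonzero operator.  Applying its column to a vector gives an intertwiner
    [T], which is injective because of the matrix units, and surjective because
    [s] is irreducible. *)
Lemma rep_complete (s : mxrep R n) : irreducible s ->
  exists2 k, (0 < rep_dim k)%N & equivalent (rep k) s.
Proof.
move=> [ds irr].
have [k [i nz]] : exists k, exists i : 'I_(rep_dim k), s (unit_elt i i) != 0.
  apply: contrapT => none.
  have : s (TLone R n) = 0.
    rewrite unit_elt_sum linear_sum big1 // => k _; rewrite linear_sum big1 // => i _.
    by apply/eqP; apply: contrapT => nz; apply: none; exists k, i; apply/negP.
  rewrite rmap1 => /matrixP /(_ (Ordinal ds) (Ordinal ds)).
  by rewrite !mxE eqxx => /eqP; rewrite oner_eq0.
have dk : (0 < rep_dim k)%N by apply: leq_ltn_trans (ltn_ord i).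
exists k => //.
have [v wnz] : exists v : 'cV_(rdim s), s (unit_elt i i) *m v != 0.
  apply: contrapT => none; case/eqP: nz; apply/matrixP => a b.
  have /colP/(_ a) : s (unit_elt i i) *m (delta_mx b 0 : 'cV_(rdim s)) = 0.
    apply/eqP; apply: contrapT => H; apply: none.
    by exists (delta_mx b 0); apply/negP.
  by rewrite -colE !mxE.
pose T : 'M[K]_(rdim s, rep_dim k) := \matrix_(a, b) (s (unit_elt b i) *m v) a 0.
have colT b : col b T = s (unit_elt b i) *m v by apply/colP => a; rewrite !mxE.
have sT f : s f *m T = T *m rep_mx k f.
  suff eqcol b : col b (s f *m T) = col b (T *m rep_mx k f).
    by apply/matrixP => a b; have /colP/(_ a) := eqcol b; rewrite ![col _ _ _ _]mxE.
  rewrite [LHS]colE -mulmxA -colE colT mulmxA -rmapM mul_unit_elt linear_sum.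
  rewrite mulmx_suml; apply/colP => a; rewrite summxE !mxE; apply: eq_bigr => x _.
  by rewrite linearZ -scalemxAl !mxE mulrC.
have Tfull : row_full T.
  rewrite /row_full -mxrank_tr -/(row_free T^T); apply: inj_row_free => c cT.
  have Tc : T *m c^T = 0 by rewrite -[T]trmxK -trmx_mul cT trmx0.
  apply/rowP => b; rewrite mxE; have := sT (unit_elt i b).
  move/(congr1 (mulmx^~ c^T)); rewrite -mulmxA Tc mulmx0 -mulmxA rep_unit_elt.
  have -> : delta_mx i b *m c^T = c 0 b *: delta_mx i 0.
    apply/colP => x; rewrite !mxE (bigD1 b) //= big1 => [|y yb].
      by rewrite !mxE !eqxx !andbT addr0 mulrC.
    by rewrite !mxE (negbTE yb) andbF mul0r.
  rewrite -scalemxAr -colE colT => /esym/eqP; rewrite scaler_eq0 (negbTE wnz) orbF.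
  by move/eqP.
pose W := limg (linfun (fun c : 'cV[K]_(rep_dim k) => T *m c)).
have Wfull : W = fullv.
  case: (irr W) => [f u /memv_imgP[c _ ->]|W0|//].
    rewrite !lfunE /= mulmxA sT -mulmxA.
    by apply/memv_imgP; exists (rep_mx k f *m c); rewrite ?memvf // lfunE.
  have : s (unit_elt i i) *m v \in W.
    by apply/memv_imgP; exists (delta_mx i 0); rewrite ?memvf // lfunE /= -colE colT.
  by rewrite W0 memv0 (negbTE wnz).
have Tfree : row_free T.
  apply: inj_row_free => x xT; apply/rowP => b.
  have : (delta_mx b 0 : 'cV[K]_(rdim s)) \in W by rewrite Wfull memvf.
  case/memv_imgP => c _; rewrite lfunE /= => e.
  have : x *m delta_mx b 0 = (0 : 'M[K]_1) by rewrite e mulmxA xT mul0mx.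
  by rewrite -colE => /colP /(_ 0); rewrite !mxE.
exists (pinvmx T), T; split; [exact: mulVpmx|exact: mulmxVp|move=> f].
by rewrite -mulmxA sT mulmxA mulVpmx // mul1mx.
Qed.

Definition reps : set (mxrep R n) := [set s | exists2 k, (0 < rep_dim k)%N & s = rep k]%classic.

Lemma reps_complete : complete_irreducibles reps.
Proof.
split=> [s [k dk ->]|s t [k dk ->] [l dl ->] /(rep_inequivalent dk) -> //|s irr].
  exact: rep_irreducible.
by have [k dk e] := rep_complete irr; exists (rep k) => //; exists k.
Qed.

Lemma fourier_rep (f : TL R n) (s : mxrep R n) : fourier f s = s f.
Proof.
have {2}-> : f = \sum_(a : D) (f a : K) *: TLbasis R a.
  apply/ffunP => c; rewrite sum_ffunE (bigD1 c) //= big1 => [|a ac].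
    by rewrite !ffunE eqxx addr0 /GRing.scale /= mulr1.
  by rewrite !ffunE eq_sym (negbTE ac) /GRing.scale /= mulr0.
by rewrite linear_sum; apply: eq_bigr => a _; rewrite linearZ.
Qed.

Lemma fft_program : exists p : slp K D,
  [/\ computes_fourier p reps,
     (additions p <= N * (n.-1 * #|D|) + #|D|)%N &
     (multiplications p <= N * (n.-1 * #|D|) + #|D|)%N].
Proof.
pose w d := (end_scale d)^-1.
have [p [reg [pa pm H]]] := slp_updates (stages q n ++ rescale w).
have sz : (size (stages q n ++ rescale w) <= N * (n.-1 * #|D|) + #|D|)%N.
  by rewrite size_cat size_rescale leq_add2r size_stages.
exists p; rewrite pa pm; split=> // s [k dk ->] i j.
have [d [_ [_ fE]]] := rep_mx_fft i j; exists (reg d) => f.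
have [t [rt _ ot]] := H f; exists t => //.
by rewrite ot foldl_cat rescaleE fourier_rep /= fE.
Qed.

End Rep.

(** * Dimension and complexity *)

Fixpoint words (N h : nat) : seq (seq bool) :=
  if N is N'.+1 then
    map (cons true) (words N' h.+1) ++
    (if h is h'.+1 then map (cons false) (words N' h') else [::])
  else if h is 0 then [:: [::]] else [::].

Lemma words_uniq N h : uniq (words N h).
Proof.
have cI b : injective (cons b : seq bool -> _) by move=> ? ? [].
elim: N h => [|N IH] [|h] //=; first by rewrite cats0 map_inj_uniq.
rewrite cat_uniq !map_inj_uniq // !IH /=.
rewrite andbT; apply/hasPn => s /mapP[t _ ->].
by apply/mapP => -[].
Qed.

Definition ups (h : nat -> nat) (N : nat) : seq bool :=
  [seq h x < h x.+1 | x <- iota 0 N].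

Lemma ups_cons h N : ups h N.+1 = (h 0 < h 1) :: ups (h \o S) N.
Proof. by rewrite /ups /= -[X in iota X N](addn0 1) iotaDl -map_comp. Qed.

Lemma wordsP N k s : reflect
  (exists h : nat -> nat, [/\ h 0 = k, h N = 0,
     forall m, m < N -> h m.+1 = (h m).+1 \/ h m = (h m.+1).+1 & s = ups h N])
  (s \in words N k).
Proof.
elim: N k s => [|N IH] k s.
  apply: (iffP idP) => [|[h [<- -> _ ->]]] //.
  by case: k => //; rewrite inE => /eqP ->; exists id.
apply: (iffP idP) => [|[h [h0 hN st ->]]].
  rewrite /= mem_cat => /orP[/mapP[t /IH[h [h0 hN st ->]] ->]|].
    exists (fun x => if x is x'.+1 then h x' else k); split=> //.
      by case=> [|m] mN; [left; rewrite h0|apply: st].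
    by rewrite ups_cons h0 ltnSn.
  case: k => // k /mapP[t /IH[h [h0 hN st ->]] ->].
  exists (fun x => if x is x'.+1 then h x' else k.+1); split=> //.
    by case=> [|m] mN; [right; rewrite h0|apply: st].
  by rewrite ups_cons h0 ltnNge leqnSn.
rewrite ups_cons /= mem_cat.
have tl : ups (h \o S) N \in words N (h 1).
  by apply/IH; exists (h \o S); split=> // m mN; apply: st.
have [e|e] := st 0 isT.
  by rewrite e ltnSn map_f // -h0 -e.
by rewrite -h0 e ltnNge leqnSn /= map_f ?orbT.
Qed.

Lemma size_words_small N h : N < h -> size (words N h) = 0.
Proof.
elim: N h => [|N IH] [|h] //= Nh; rewrite size_cat !size_map !IH //; lia.
Qed.

(** The binomial coefficient at [b - 1], which is 0 for [b = 0]. *)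
Definition binp (N b : nat) : nat := if b is b'.+1 then 'C(N, b') else 0.

(** The reflection principle in the form of a recursion: both sides satisfy
    the rule of Pascal. *)
Lemma size_words N h b : N = h + b.*2 -> size (words N h) + binp N b = 'C(N, b).
Proof.
elim: N h b => [|N IH] h b e.
  have -> : h = 0 by lia.
  by have -> : b = 0 by lia.
case: b e => [|b] e.
  rewrite /binp bin0 addn0 /= size_cat !size_map size_words_small; last by lia.
  by case: h e => [|h] e; [lia|rewrite size_map; have := IH h 0 ltac:(lia); rewrite bin0 addn0].
have := IH h.+1 b ltac:(lia).
case: h e => [|h] e /=.
  move=> H; rewrite cats0 size_map [RHS]binS; move: H.
  have -> : 'C(N, b.+1) = 'C(N, b) by rewrite -bin_sub; [congr 'C(_, _)|]; lia.
  by case: b e => [|b] e /=; rewrite ?bin0 ?binS; lia.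
have := IH h b.+1 ltac:(lia).
rewrite size_cat !size_map binS /=.
by case: b e => [|b] e /=; rewrite ?bin0 ?binS; lia.
Qed.

Lemma catalan_words n : 0 < n -> size (words (n + n) 0) * n.+1 = 'C(n.*2, n).
Proof.
case: n => // n _; have := @size_words (n.+1 + n.+1) 0 n.+1 ltac:(lia).
have := mul_bin_left (n.+1 + n.+1) n; rewrite /binp -addnn.
have -> : n.+1 + n.+1 - n = n.+2 by lia.
by move=> E H; move: E; rewrite -H; nia.
Qed.

(** The word of openers determines a diagram, and every ballot word occurs by
    [path_matching]. *)
Lemma card_diagram n : #|diagram n| = size (words (n + n) 0).
Proof.
pose word (d : diagram n) := ups (height (mate d)) (n + n).
have wI : injective word.
  move=> d e /eq_in_map E; apply: mate_inj.
  apply: (ncmatch_ext (mate_ncmatch d) (mate_ncmatch e)) => x xN.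
  by rewrite -!(height_ltE (mate_ncmatch _)) // E // mem_iota.
have uw : uniq [seq word d | d <- enum (diagram n)] by rewrite (map_inj_uniq wI) enum_uniq.
rewrite cardE -(size_map word); apply/eqP.
rewrite eq_sym -(uniq_size_uniq uw) ?words_uniq // => s.
apply/mapP/wordsP => [[d _ ->]|[h [h0 hN st ->]]].
  by have [? ? ?] := height_path (mate_ncmatch d); exists (height (mate d)).
have hp : is_path (n + n) 0 h by [].
have [g ng gE] := path_matching hp; have [d dE] := ncmatch_diagram ng.
exists d; first by rewrite mem_enum.
apply/eq_in_map => x; rewrite mem_iota => /andP[_ xN].
by rewrite (height_ltE (mate_ncmatch d)) // dE // gE.
Qed.

Lemma card_diagram_catalan n : 0 < n -> #|diagram n| = catalan n.
Proof. by move=> n0; rewrite card_diagram /catalan -catalan_words // mulnK. Qed.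

Lemma card_diagram_growth n : 2 ^ n <= #|diagram n.+1|.
Proof.
elim: n => [|n IH].
  by rewrite card_diagram.
have e1 := @catalan_words n.+1 isT; have e2 := @catalan_words n.+2 isT.
rewrite -!card_diagram in e1 e2.
have b1 := mul_bin_diag n.+2.*2 n.+1; have b2 := mul_bin_down n.+1.*2.+1 n.+1.
have e3 : n.+2 * 'C(n.+2.*2, n.+2) = (2 * (n.+1.*2).+1) * 'C(n.+1.*2, n.+1).
  have h1 : n.+2.*2.-1 = n.+1.*2.+1 by lia.
  rewrite h1 in b1; rewrite -[_.+1.-1]/(n.+1.*2) in b2.
  have h2 : n.+1.*2.+1 - n.+1 = n.+2 by lia.
  rewrite h2 in b2; nia.
rewrite -e1 -e2 in e3; rewrite expnS.
move: (#|diagram n.+1|) (#|diagram n.+2|) IH e3 => x y IH e3.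
have : n.+3 * y = (2 * (n.+1.*2).+1) * x by nia.
nia.
Qed.


Local Open Scope classical_set_scope.
Local Open Scope ring_scope.

Lemma TLdim_card (R : realType) n : TLdim R n = #|diagram n|.
Proof. by rewrite /TLdim dimvf /dim /= muln1. Qed.

Lemma TLdim_catalan (R : realType) n : (1 <= n)%N -> TLdim R n = catalan n.
Proof. by move=> n1; rewrite TLdim_card card_diagram_catalan. Qed.

(** With [n = m + 1], the bound exceeds the [2 n (n - 1) + 1] operations per
    diagram by [(m ^ 3 + 17 m) / 6]. *)
Lemma complexity_bound (R : realType) n : (1 <= n)%N ->
  (complexity R n <= (TLbound R n)%:E)%E.
Proof.
move=> n1; have [p [pf pa pm]] := fft_program R n.
have bound m : (m <= (n + n) * (n.-1 * #|diagram n|) + #|diagram n|)%N ->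
    (m%:R <= TLbound R n)%R.
  move=> mb; have {mb} : (m%:R <= ((n + n) * (n.-1 * #|diagram n|) + #|diagram n|)%:R :> R)%R.
    by rewrite ler_nat.
  move=> /le_trans; apply; rewrite /TLbound TLdim_card.
  case: n n1 {p pf pa pm} => // n _; rewrite succnK.
  rewrite -[n.+1]addn1 !(natrD, natrM).
  set D : R := #|_|%:R; set x : R := n%:R.
  have D0 : 0 <= D by apply: ler0n.
  have x0 : 0 <= x by apply: ler0n.
  have -> : (x + 1 + (x + 1)) * (x * D) + D = (2 * (x + 1) * x + 1) * D by ring.
  apply: ler_wpM2r => //.
  rewrite ler_pdivlMr //; have := exprn_ge0 3 x0 => x3.
  by nra.
apply: le_trans (_ : cost (@reps R n) <= _)%E.
  by apply: ereal_inf_lbound; exists (@reps R n) => //; apply: reps_complete.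
rewrite /cost ge_max; apply/andP; split.
  apply: le_trans (_ : (additions p)%:R%:E <= _)%E; last by rewrite lee_fin bound.
  by apply: ereal_inf_lbound; exists p.
apply: le_trans (_ : (multiplications p)%:R%:E <= _)%E; last by rewrite lee_fin bound.
by apply: ereal_inf_lbound; exists p.
Qed.

(** For [n >= 2] the bound is at most [24 (n - 1) ^ 3] times the dimension, and
    [(n - 1) ln 2] is at most the logarithm of the dimension. *)
Lemma TLbound_bigO (R : realType) :
  (TLbound R : nat -> R) =O_\oo
    (fun n : nat => (TLdim R n)%:R * (ln (TLdim R n)%:R) ^+ 3).
Proof.
have l2 : 0 < ln (2 : R) by apply: ln_gt0; lra.
apply/eqO_exP; exists (24 / ln 2 ^+ 3); first by rewrite divr_gt0 ?exprn_gt0 //; lra.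
exists 2%N => // n /= n2.
case: n n2 => [|n] //; rewrite ltnS => n1.
set D : R := (TLdim R n.+1)%:R.
have DE : (2 : R) ^+ n <= D by rewrite /D TLdim_card -natrX ler_nat card_diagram_growth.
have Dpos : 0 < D by apply: lt_le_trans DE; rewrite exprn_gt0 //; lra.
have lD : n%:R * ln (2 : R) <= ln D.
  rewrite mulr_natl -lnXn ?ler_ln ?posrE ?exprn_gt0 //; lra.
have x1 : 1 <= n%:R :> R by rewrite ler1n.
rewrite /TLbound -/D -[n.+1]addn1 natrD.
set x : R := n%:R in x1 lD *.
have lD3 : x ^+ 3 * ln 2 ^+ 3 <= ln D ^+ 3.
  by rewrite -exprMn lerXn2r ?nnegrE //; [rewrite mulr_ge0 //; lra|apply: le_trans lD; rewrite mulr_ge0 //; lra].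
have lD0 : 0 <= ln D ^+ 3 by apply: le_trans lD3; rewrite mulr_ge0 ?exprn_ge0 //; lra.
have x3 : 0 <= x ^+ 3 by rewrite exprn_ge0 //; lra.
have B0 : 0 <= ((x + 1) ^+ 3 + 9 * (x + 1) ^+ 2 + 8 * (x + 1) - 12) / 6.
  by rewrite divr_ge0 //; nra.
rewrite (ger0_norm (mulr_ge0 B0 (ltW Dpos))) (ger0_norm (mulr_ge0 (ltW Dpos) lD0)).
rewrite [leRHS]mulrCA [leLHS]mulrC; apply: ler_wpM2l; first exact: ltW.
have l23 : 0 < ln (2 : R) ^+ 3 by rewrite exprn_gt0.
rewrite mulrAC ler_pdivlMr //.
apply: le_trans (_ : 24 * (x ^+ 3 * ln 2 ^+ 3) <= _); last by apply: ler_wpM2l => //; lra.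
rewrite mulrA; apply: ler_wpM2r; first exact: ltW.
rewrite ler_pdivrMr //.
nra.
Qed.

Theorem theorem1p3 (R : realType) :
  (forall n : nat, (1 <= n)%N ->
     TLdim R n = catalan n /\
     (complexity R n <= (TLbound R n)%:E)%E) /\
  (TLbound R : nat -> R) =O_\oo
    (fun n : nat => (TLdim R n)%:R * (ln (TLdim R n)%:R) ^+ 3).
Proof.
split; last exact: TLbound_bigO.
by move=> n n1; split; [exact: TLdim_catalan|exact: complexity_bound].
Qed.
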